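(* Consider the system $$x_i'(t)=a_i(t,x_i(t))\Big[-b_i(t,x_i(t))+F_i\Big(\sum_{p=1}^{P}\sum_{j,l=1}^{n}c_{ijlp}(t)h_{ijlp}\big(x_j(t-\tau_{ijp}(t)),x_l(t-\tilde\tau_{ilp}(t))\big),\ \sum_{p=1}^{P}\sum_{j,l=1}^{n}d_{ijlp}(t)f_{ijlp}\Big(\int_{-\infty}^0 g_{ijp}(x_j(t+s))\,d\eta_{ijp}(s),\int_{-\infty}^0\tilde g_{ilp}(x_l(t+s))\,d\tilde\eta_{ilp}(s)\Big)\Big)+I_i(t)\Big],\quad t\ge 0,\ i=1,\dots,n,\qquad (S)$$ with data as described in the context. Assume: (i) for each $i,j,l,p$ and $u\in\mathbb{R}$, the functions $c_{ijlp},d_{ijlp},I_i$ and $b_i(\cdot,u)$ are bounded on $[0,+\infty)$; (ii) for each $i$, the partial derivative $\partial a_i/\partial t$ exists and there are $\underline a_i,\overline a_i>0$ and a function $A_i:[0,+\infty)\to\mathbb{R}$ such that $\underline a_i\le a_i(t,v)\le\overline a_i$ and $A_i(t)a_i^2(t,v)\le \frac{\partial}{\partial t}a_i(t,v)$ for all $t\ge 0$, $v\in\mathbb{R}$; (iii) for each $i$, there is a continuous $\beta_i:[0,+\infty)\to[0,+\infty)$ such that $\frac{b_i(t,u)-b_i(t,v)}{u-v}\ge\beta_i(t)$ for all $t\ge0$ and $u,v\in\mathbb{R}$ with $u\ne v$; (iv) for each $i,j,l,p$, $\lim_{t\to+\infty}(t-\tau_{ijp}(t))=\lim_{t\to+\infty}(t-\tilde\tau_{ilp}(t))=+\infty$;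 (v) for each $i,j,l,p$ there are $\gamma^{(1)}_{ijlp},\gamma^{(2)}_{ijlp},\mu^{(1)}_{ijlp},\mu^{(2)}_{ijlp}>0$ such that $|h_{ijlp}(u_1,u_2)-h_{ijlp}(v_1,v_2)|\le\gamma^{(1)}_{ijlp}|u_1-v_1|+\gamma^{(2)}_{ijlp}|u_2-v_2|$ and $|f_{ijlp}(u_1,u_2)-f_{ijlp}(v_1,v_2)|\le\mu^{(1)}_{ijlp}|u_1-v_1|+\mu^{(2)}_{ijlp}|u_2-v_2|$ for all $u_1,u_2,v_1,v_2\in\mathbb{R}$; (vi) for each $i,j,p$ there are $\xi_{ijp},\tilde\xi_{ijp},\zeta_i,\varsigma_i>0$ such that $|g_{ijp}(u_1)-g_{ijp}(v_1)|\le\xi_{ijp}|u_1-v_1|$, $|\tilde g_{ijp}(u_1)-\tilde g_{ijp}(v_1)|\le\tilde\xi_{ijp}|u_1-v_1|$ and $|F_i(u_1,u_2)-F_i(v_1,v_2)|\le\zeta_i|u_1-v_1|+\varsigma_i|u_2-v_2|$ for all $u_1,u_2,v_1,v_2\in\mathbb{R}$; (vii) there is $d=(d_1,\dots,d_n)$ with all $d_i>0$ such that, for each $i=1,\dots,n$, $$\limsup_{t\to+\infty}\Big[-\underline a_i\big(\beta_i(t)+A_i(t)\big)+\sum_{p=1}^{P}\sum_{j,l=1}^{n}\Big(\zeta_i|c_{ijlp}(t)|\Big(\overline a_j\tfrac{d_j}{d_i}\gamma^{(1)}_{ijlp}+\overline a_l\tfrac{d_l}{d_i}\gamma^{(2)}_{ijlp}\Big)+\varsigma_i|d_{ijlp}(t)|\Big(\overline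 a_j\tfrac{d_j}{d_i}\xi_{ijp}\mu^{(1)}_{ijlp}+\overline a_l\tfrac{d_l}{d_i}\tilde\xi_{ilp}\mu^{(2)}_{ijlp}\Big)\Big)\Big]<0.$$ Let $$x_i'(t)=a_i(t,x_i(t))\Big[-\hat b_i(t,x_i(t))+F_i\Big(\sum_{p=1}^{P}\sum_{j,l=1}^{n}\hat c_{ijlp}(t)h_{ijlp}\big(x_j(t-\hat\tau_{ijp}(t)),x_l(t-\hat{\tilde\tau}_{ilp}(t))\big),\ \sum_{p=1}^{P}\sum_{j,l=1}^{n}\hat d_{ijlp}(t)f_{ijlp}\Big(\int_{-\infty}^0 g_{ijp}(x_j(t+s))\,d\eta_{ijp}(s),\int_{-\infty}^0\tilde g_{ilp}(x_l(t+s))\,d\tilde\eta_{ilp}(s)\Big)\Big)+\hat I_i(t)\Big],\quad t\ge0,\ i=1,\dots,n,\qquad (\hat S)$$ be an asymptotic system of (S) (in the sense defined in the context, with the functions $\beta_i$ of (iii)). Then $$\lim_{t\to+\infty}|x(t)-\hat x(t)|=0$$ for every solution $x(t)$ of (S) and every solution $\hat x(t)$ of $(\hat S)$ with bounded initial conditions.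
   Context: $n,P\in\mathbb{N}$; indices $i,j,l$ range over $\{1,\dots,n\}$ and $p$ over $\{1,\dots,P\}$. The functions $a_i:[0,+\infty)\times\mathbb{R}\to(0,+\infty)$, $b_i:[0,+\infty)\times\mathbb{R}\to\mathbb{R}$, $c_{ijlp},d_{ijlp},I_i:[0,+\infty)\to\mathbb{R}$, $\tau_{ijp},\tilde\tau_{ilp}:[0,+\infty)\to[0,+\infty)$, $F_i,h_{ijlp},f_{ijlp}:\mathbb{R}^2\to\mathbb{R}$, $g_{ijp},\tilde g_{ilp}:\mathbb{R}\to\mathbb{R}$ are continuous, and $\eta_{ijp},\tilde\eta_{ilp}:(-\infty,0]\to\mathbb{R}$ are non-decreasing bounded functions with $\eta_{ijp}(0)-\eta_{ijp}(-\infty)=\tilde\eta_{ilp}(0)-\tilde\eta_{ilp}(-\infty)=1$, where $\eta(-\infty)=\lim_{s\to-\infty}\eta(s)$; integrals against them are Stieltjes integrals. Asymptotic system: $(\hat S)$ is an asymptotic system of (S) if, for all $i,j,l,p$, the functions $\hat b_i:[0,+\infty)\times\mathbb{R}\to\mathbb{R}$, $\hat c_{ijlp},\hat d_{ijlp},\hat I_i:[0,+\infty)\to\mathbb{R}$, $\hat\tau_{ijp},\hat{\tilde\tau}_{ilp}:[0,+\infty)\to[0,+\infty)$ are continuous; there is a continuous function $\hat\beta_i:[0,+\infty)\to[0,+\infty)$ with $\frac{\hat b_i(t,u)-\hat b_i(t,v)}{u-v}\ge\hat\beta_i(t)$ for all $t\ge0$, $u\neq v$; and, as $t\to+\infty$,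 each of $\beta_i(t)-\hat\beta_i(t)$, $b_i(t,w(t))-\hat b_i(t,w(t))$ (for every bounded continuous $w:\mathbb{R}\to\mathbb{R}$), $c_{ijlp}(t)-\hat c_{ijlp}(t)$, $d_{ijlp}(t)-\hat d_{ijlp}(t)$, $\tau_{ijp}(t)-\hat\tau_{ijp}(t)$, $\tilde\tau_{ilp}(t)-\hat{\tilde\tau}_{ilp}(t)$, $I_i(t)-\hat I_i(t)$ tends to $0$. $BC$ is the space of bounded continuous functions $\phi:(-\infty,0]\to\mathbb{R}^n$; $x_t(s)=x(t+s)$ for $s\le0$; $|\cdot|$ is the maximum norm on $\mathbb{R}^n$. A solution with bounded initial condition is a continuous function $x$ on an interval $(-\infty,t^* )$ such that, for some $t_0\ge0$ and $\phi\in BC$, $t_0<t^*\le+\infty$, $x_{t_0}=\phi$, and $x$ is continuously differentiable and satisfies the system on $[t_0,t^* )$ (one-sided derivative at $t_0$). Solutions are understood to be noncontinuable (maximal); under the hypotheses they are defined on $\mathbb{R}$. *)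

(* Defs.v *)
From HB Require Import structures.
From mathcomp Require Import all_boot all_order all_algebra.
From mathcomp Require Import all_classical all_reals all_analysis.

Set Implicit Arguments.
Unset Strict Implicit.
Unset Printing Implicit Defensive.

Import Order.TTheory GRing.Theory Num.Theory.
Import numFieldNormedType.Exports.

Local Open Scope classical_set_scope.
Local Open Scope ring_scope.

(* Functions whose mathematical domain is [0, +oo[, [0, +oo[ * R, ]-oo, 0] or
   ]-oo, tstar[ are represented by total functions; only their values on that
   domain are ever constrained or used.  The space R^n is 'rV[R]_n, whose
   library norm is the maximum norm. *)

(* The derivative of f at t relative to D: it is one-sided at an end point of
   an interval D, and the usual derivative at an interior point. *)
Definition derivative_within (R : realType) (D : set R) (f : R -> R)
    (t l : R) : Prop :=
  (f s - f t) / (s - t) @[s --> within D t^'] --> l.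

Record bounded_nondecreasing (R : realType) := BoundedNondecreasing {
  bnd_fun :> R -> R ;
  bnd_nondecreasing : {in `]-oo, 0] &, {homo bnd_fun : x y / x <= y}} ;
  bnd_bounded : [bounded bnd_fun s | s in `]-oo, 0]%classic] }.

Section stieltjes.
Context {R : realType}.
Implicit Type eta : bounded_nondecreasing R.

(* lebesgue_stieltjes_measure expects a right-continuous non-decreasing
   function on the whole line, whereas eta is only non-decreasing on ]-oo, 0].
   So eta is extended by the constant eta 0 on the right of 0 and then replaced
   by its right limits eta (s+) = inf_(r > s) eta r.  The resulting measure
   gives mass eta (b+) - eta (a+) to ]a, b] when a <= b < 0, mass
   eta 0 - eta (a+) to ]a, 0] when a < 0 (a jump of eta at 0 is an atom at 0),
   and no mass to ]0, +oo[; against continuous integrands it coincides with the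
   Riemann-Stieltjes integral. *)
Definition right_limits eta (s : R) : R :=
  inf [set eta (Num.min r 0) | r in `]s, +oo[].

Lemma right_limits_has_inf eta s :
  has_inf [set eta (Num.min r 0) | r in `]s, +oo[].
Proof.
split; first by exists (eta (Num.min (s + 1) 0)), (s + 1) => //=;
  rewrite in_itv/= andbT ltrDl.
have [M [_ /(_ (M + 1))]] := bnd_bounded eta.
rewrite ltrDl => /(_ ltr01) HM; exists (- (M + 1)) => _ [r _ <-].
have : `|eta (Num.min r 0)| <= M + 1.
  by apply: HM; rewrite /= in_itv/= ge_min lexx orbT.
by rewrite ler_norml => /andP[].
Qed.

Lemma right_limits_nondecreasing eta : nondecreasing (right_limits eta).
Proof.
move=> s t st; apply: lb_le_inf; first by case: (right_limits_has_inf eta t).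
move=> _ [r /= tr <-]; apply: ge_inf.
  by case: (right_limits_has_inf eta s).
exists r => //=; move: tr; rewrite !in_itv/= !andbT.
exact: le_lt_trans.
Qed.

Lemma right_limits_right_continuous eta :
  right_continuous (right_limits eta).
Proof.
move=> s; apply/cvgrPdist_lt => e e0.
have [_ [r /= + <-] re] := inf_adherent e0 (right_limits_has_inf eta s).
rewrite in_itv/= andbT => sr.
near=> t.
have st : s < t by near: t; exact: nbhs_right_gt.
have tr : t < r by near: t; exact: nbhs_right_lt.
rewrite distrC ger0_norm ?subr_ge0 ?right_limits_nondecreasing ?ltW//.
rewrite ltrBlDl; apply: le_lt_trans re; apply: ge_inf.
  by case: (right_limits_has_inf eta t).
by exists r => //=; rewrite in_itv/= andbT.
Unshelve. all: by end_near. Qed.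

HB.instance Definition _ eta := isCumulative.Build R _ R (right_limits eta)
  (@right_limits_nondecreasing eta) (@right_limits_right_continuous eta).

Definition stieltjes_integral eta (g : R -> R) : R :=
  \int[lebesgue_stieltjes_measure (right_limits eta)]_(s in `]-oo, 0]) g s.

End stieltjes.

Section system.
Context {R : realType} {n P : nat}.

(* The right-hand side of the i-th equation at time t along the path x. *)
Definition rhs
    (a b : 'I_n -> R * R -> R) (F : 'I_n -> R * R -> R)
    (c d : 'I_n -> 'I_n -> 'I_n -> 'I_P -> R -> R)
    (h f : 'I_n -> 'I_n -> 'I_n -> 'I_P -> R * R -> R)
    (tau tau' : 'I_n -> 'I_n -> 'I_P -> R -> R)
    (g g' : 'I_n -> 'I_n -> 'I_P -> R -> R)
    (eta eta' : 'I_n -> 'I_n -> 'I_P -> bounded_nondecreasing R)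
    (I : 'I_n -> R -> R) (x : R -> 'rV[R]_n) (i : 'I_n) (t : R) : R :=
  a i (t, x t 0 i) *
  (- b i (t, x t 0 i)
   + F i (\sum_(p < P) \sum_(j < n) \sum_(l < n)
            c i j l p t *
            h i j l p (x (t - tau i j p t) 0 j, x (t - tau' i l p t) 0 l),
          \sum_(p < P) \sum_(j < n) \sum_(l < n)
            d i j l p t *
            f i j l p
              (stieltjes_integral (eta i j p)
                 (fun s => g i j p (x (t + s) 0 j)),
               stieltjes_integral (eta' i l p)
                 (fun s => g' i l p (x (t + s) 0 l))))
   + I i t).

Definition BC (phi : R -> 'rV[R]_n) : Prop :=
  {within `]-oo, 0], continuous phi} /\ [bounded phi s | s in `]-oo, 0]%classic].

(* x is a solution, on ]-oo, tstar[ and with a bounded initial condition, of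
   the system x_i'(t) = G x i t. *)
Definition solution (G : (R -> 'rV[R]_n) -> 'I_n -> R -> R) (tstar : \bar R)
    (x : R -> 'rV[R]_n) : Prop :=
  {within [set t | t%:E < tstar]%E, continuous x} /\
  exists (t0 : R) (phi : R -> 'rV[R]_n),
    [/\ 0 <= t0, (t0%:E < tstar)%E, BC phi,
        forall s, s <= 0 -> x (t0 + s) = phi s
      & let J := [set t | t0 <= t /\ (t%:E < tstar)%E] in
        forall i,
          {within J, continuous (G x i)} /\
          forall t, J t -> derivative_within J (fun s => x s 0 i) t (G x i t)].

(* The functions with suffix H are those of the asymptotic system. *)
Definition asymptotic_system
    (b : 'I_n -> R * R -> R) (beta : 'I_n -> R -> R)
    (c d : 'I_n -> 'I_n -> 'I_n -> 'I_P -> R -> R)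
    (tau tau' : 'I_n -> 'I_n -> 'I_P -> R -> R) (I : 'I_n -> R -> R)
    (bH : 'I_n -> R * R -> R)
    (cH dH : 'I_n -> 'I_n -> 'I_n -> 'I_P -> R -> R)
    (tauH tau'H : 'I_n -> 'I_n -> 'I_P -> R -> R) (IH : 'I_n -> R -> R)
    : Prop :=
  (forall i, {within [set z | 0 <= z.1], continuous (bH i)}) /\
  (forall i j l p, {within `[0, +oo[, continuous (cH i j l p)} /\
                   {within `[0, +oo[, continuous (dH i j l p)}) /\
  (forall i, {within `[0, +oo[, continuous (IH i)}) /\
  (forall i j p, {within `[0, +oo[, continuous (tauH i j p)} /\
                 {within `[0, +oo[, continuous (tau'H i j p)}) /\
  (forall i j p t, 0 <= t -> 0 <= tauH i j p t /\ 0 <= tau'H i j p t) /\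
  (forall i, exists betaH : R -> R,
      [/\ {within `[0, +oo[, continuous betaH},
          forall t, 0 <= t -> 0 <= betaH t,
          forall t u v, 0 <= t -> u != v ->
            betaH t <= (bH i (t, u) - bH i (t, v)) / (u - v)
        & beta i t - betaH t @[t --> +oo] --> 0]) /\
  (forall i (w : R -> R), continuous w -> bounded_fun w ->
     b i (t, w t) - bH i (t, w t) @[t --> +oo] --> 0) /\
  (forall i j l p, c i j l p t - cH i j l p t @[t --> +oo] --> 0 /\
                   d i j l p t - dH i j l p t @[t --> +oo] --> 0) /\
  (forall i j p, tau i j p t - tauH i j p t @[t --> +oo] --> 0 /\
                 tau' i j p t - tau'H i j p t @[t --> +oo] --> 0) /\
  (forall i, I i t - IH i t @[t --> +oo] --> 0).

End system.

(* Main.v *)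
Require Import Defs.
From HB Require Import structures.
From mathcomp Require Import all_boot all_order all_algebra.
From mathcomp Require Import all_classical all_reals all_analysis.
From mathcomp Require Import measurable_realfun.
From mathcomp Require Import ring lra.

Set Implicit Arguments.
Unset Strict Implicit.
Unset Printing Implicit Defensive.

Import Order.TTheory GRing.Theory Num.Theory.
Import numFieldNormedType.Exports.

Local Open Scope classical_set_scope.
Local Open Scope ring_scope.

(* Let Phi_i (t, .) be a primitive of 1 / a_i (t, .) and put
   Z_i (t) = Phi_i (t, x_i (t)) - Phi_i (t, y_i (t)), which has the sign and,
   up to constants, the size of x_i - y_i.  The weight a_i disappears from the
   right derivative of |Z_i|, and (ii), (iii) bound it by
   - (beta_i + A_i) |x_i - y_i| + |difference of the nonlinear terms| + |r_i|
   when y solves (S) up to a defect r.  By (vii), if |Z_j| <= w_j M for all j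
   in the past, then the damping dominates the nonlinear terms at the level
   w_i M by a margin eps w_i M.  With r bounded, |Z_i| therefore cannot cross
   w_i M for M large, so x - y is bounded; applied to (S^) and y = 0 this
   bounds x^.  With r -> 0, an eventual bound w_i Lam on |Z_i| improves to
   kappa w_i Lam for a fixed kappa < 1, so x - y -> 0.  Finally, x^ is bounded
   and Lipschitz, hence solves (S) up to a defect tending to 0.

   Neither differentiability of Z_i nor continuity of da_i/dt is available:
   only one-sided estimates of the increments of Z_i are used. *)

(** * Stieltjes integrals against a normalized integrator *)

(** The constants of (vii) come from the slope of Phi_i, which lies between 1 / a_up and 1 / a_low:
    |x_j - y_j| <= a_up |Z_j| puts [a_up] into the nonlinear terms, and x_i - y_i >= a_low Z_i for
    Z_i > 0 puts [a_low] into the damping. The term A_i comes from the motion of Phi_i in time,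
    since the t-derivative of 1 / a_i is at most - A_i. Two obstacles fix the order of the argument.
    The integrals see the whole past, so a bound on recent values never controls them alone; a
    global bound on x - y must come first, and the remote past then contributes this bound times a
    mass that tends to 0. Moreover b - b^ is known to vanish only along bounded functions, so x^
    cannot be inserted there before it is known to be bounded. Until then only constants are
    available as test functions, which is why x^ is first compared with 0 inside (S^). Boundedness
    also makes x^ Lipschitz, and this is what allows the delays of the two systems to be
    exchanged. *)

Section stieltjes.
Context {R : realType} (eta : bounded_nondecreasing R).
Hypothesis eta_mass : eta 0 - lim (eta s @[s --> -oo]) = 1.

Local Notation mu := (lebesgue_stieltjes_measure (right_limits eta)).

Lemma lim_le_bounded_nondecreasing s : s <= 0 ->
  lim (eta s @[s --> -oo]) <= eta s.
Proof.
move=> s0.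
(* [eta] is constrained only on the left of 0. Its truncation is monotone on the whole line and
   agrees with it near -oo, so the limit is the infimum of the truncation. *)
pose f (t : R) := eta (Num.min t 0).
have ndf : {homo f : x y / x <= y}.
  move=> x y xy; apply: bnd_nondecreasing.
  - by rewrite in_itv/= ge_min lexx orbT.
  - by rewrite in_itv/= ge_min lexx orbT.
  - by rewrite le_min !ge_min xy lexx orbT.
have lbf : has_lbound (range f).
  have [M [_ /(_ (M + 1))]] := bnd_bounded eta.
  rewrite ltrDl => /(_ ltr01) HM; exists (- (M + 1)) => _ [r _ <-].
  have : `|eta (Num.min r 0)| <= M + 1.
    by apply: HM; rewrite /= in_itv/= ge_min lexx orbT.
  by rewrite ler_norml => /andP[].
have H2 : eta s @[s --> -oo] --> inf (range f).
  apply/cvgrPdist_lt => e e0.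
  have [_ [r _ <-] re] := inf_adherent e0 (conj (ex_intro _ _ (ex_intro2 _ _ 0 Logic.I erefl)) lbf).
  near=> t.
  have -> : eta t = f t.
    by rewrite /f minEle ifT//; near: t; apply: nbhs_ninfty_le; rewrite num_real.
  rewrite distrC ger0_norm ?subr_ge0; last by apply: ge_inf => //; exists t.
  rewrite ltrBlDl; apply: le_lt_trans re; apply: ndf.
  by near: t; apply: nbhs_ninfty_le; rewrite num_real.
rewrite (cvg_lim _ H2)//.
have -> : eta s = f s by rewrite /f minEle s0.
by apply: ge_inf => //; exists s.
Unshelve. all: by end_near. Qed.

(** The mass is the difference of the right limits at 0 and at [a]; the former is at most [eta 0],
    the latter at least the limit at -oo. An upper bound is enough, because the mass only multiplies
    error bounds. *)
Lemma stieltjes_oc a : a <= 0 -> (mu `]a, 0%R] <= 1)%E.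
Proof.
move=> a0.
rewrite /lebesgue_stieltjes_measure /measure_extension measurable_mu_extE/=; last exact: is_ocitv.
rewrite wlength_itv_bnd// lee_fin -eta_mass lerB//.
- apply: ge_inf; first by case: (right_limits_has_inf eta 0).
  by exists 1; [rewrite /= in_itv/= ltr01|rewrite minEle ler10].
- apply: lb_le_inf; first by case: (right_limits_has_inf eta a).
  move=> _ [r _ <-]; apply: lim_le_bounded_nondecreasing.
  by rewrite ge_min lexx orbT.
Qed.

Lemma stieltjes_mass : (mu `]-oo, 0%R] <= 1)%E.
Proof.
have E : `]-oo, (0:R)]%classic = \bigcup_(k : nat) `](- k%:R), 0]%classic.
  apply/seteqP; split => [x /=|x [k _ /=]].
    rewrite in_itv/= => x0; exists (Num.bound (- x)) => //=.
    by rewrite in_itv/= x0 andbT ltrNl archi_boundP// oppr_ge0.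
  by rewrite !in_itv/= => /andP[].
rewrite E.
have /cvg_lim <- // : (mu \o (fun k : nat => `](- k%:R), (0:R)]%classic)) @ \oo -->
    mu (\bigcup_(k : nat) `](- k%:R), (0:R)]%classic).
  apply: nondecreasing_cvg_mu.
  - by move=> k; exact: measurable_itv.
  - by apply: bigcup_measurable => k _; exact: measurable_itv.
  - apply/nondecreasing_seqP => k; apply/subsetPset => x /=.
    rewrite !in_itv/= => /andP[kx ->]; rewrite andbT.
    by apply: le_lt_trans kx; rewrite lerN2 ler_nat.
apply: lime_le; last by near=> k; apply: stieltjes_oc; rewrite oppr_le0.
apply: ereal_nondecreasing_is_cvgn => m n mn.
apply: le_measure; rewrite ?inE; [exact: measurable_itv..|].
move=> x /=; rewrite !in_itv/= => /andP[kx ->]; rewrite andbT.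
by apply: le_lt_trans kx; rewrite lerN2 ler_nat.
Unshelve. all: by end_near. Qed.

Lemma stieltjes_mass_lty : (mu `]-oo, 0%R] < +oo)%E.
Proof. by apply: le_lt_trans stieltjes_mass _; rewrite ltry. Qed.

Lemma stieltjes_mass_fin : mu `]-oo, (0:R)] \is a fin_num.
Proof.
by rewrite ge0_fin_numE// stieltjes_mass_lty. Qed.

Lemma stieltjes_mass_le1 : fine (mu `]-oo, (0:R)]) <= 1.
Proof.
by rewrite -lee_fin fineK ?stieltjes_mass_fin//; exact: stieltjes_mass.
Qed.

Lemma stieltjes_sub_fin (A : set R) : measurable A -> A `<=` `]-oo, 0]%classic ->
  mu A \is a fin_num.
Proof.
move=> mA A0; rewrite ge0_fin_numE//.
apply: (@le_lt_trans _ _ (mu `]-oo, 0]%classic)).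
  by apply: le_measure; rewrite ?inE.
exact: stieltjes_mass_lty.
Qed.

(** The minimum keeps the half-line inside ]-oo, 0], where the mass is known to be finite, also for
    negative [r]. *)
Definition stieltjes_tail (r : R) : R := fine (mu `]-oo, Num.min (- r) 0]).

Lemma stieltjes_tail_nincr r s : r <= s -> stieltjes_tail s <= stieltjes_tail r.
Proof.
move=> rs; have sub (u v : R) : u <= v -> `]-oo, u] `<=` `]-oo, v].
  by move=> uv x /=; rewrite !in_itv/= => /le_trans; exact.
apply: fine_le.
- by apply: stieltjes_sub_fin => //; apply: sub; rewrite ge_min lexx orbT.
- by apply: stieltjes_sub_fin => //; apply: sub; rewrite ge_min lexx orbT.
- apply: le_measure; rewrite ?inE//; apply: sub.
  by rewrite le_min !ge_min lerN2 rs lexx orbT.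
Qed.

(** Continuity from above of a finite measure along the integers; monotonicity of the tail extends
    it to real [r]. *)
Lemma stieltjes_tail_cvg : stieltjes_tail r @[r --> +oo] --> (0 : R).
Proof.
pose F (k : nat) := `]-oo, (- k%:R : R)]%classic.
have F0 k : F k `<=` `]-oo, (0:R)].
  by move=> x; rewrite /F /= !in_itv/= => /le_trans; apply; rewrite oppr_le0.
have : mu \o F @ \oo --> mu (\bigcap_n F n).
  apply: nonincreasing_cvg_mu.
  - apply: (@le_lt_trans _ _ (mu `]-oo, 0%R])); last exact: stieltjes_mass_lty.
    by apply: le_measure; rewrite ?inE//; exact: measurable_itv.
  - by move=> k; exact: measurable_itv.
  - by apply: bigcap_measurable => // k _; exact: measurable_itv.
  - apply/nonincreasing_seqP => k; apply/subsetPset => x /=.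
    rewrite /F/= !in_itv/= => /le_trans; apply.
    by rewrite lerN2 ler_nat.
rewrite (_ : \bigcap_n F n = set0); last first.
  apply/seteqP; split => // x /(_ (Num.bound `|x|) Logic.I).
  rewrite /F/= in_itv/= lerNr => /(lt_le_trans (archi_boundP (normr_ge0 x))).
  by rewrite ltNge -normrN ler_norm.
rewrite measure0 => /fine_cvg muF.
apply/cvgrPdist_lt => e e0.
have /cvgrPdist_lt/(_ _ e0)[N _ /(_ N (leqnn N))] := muF.
rewrite /= !sub0r !normrN => HN.
near=> r; rewrite sub0r normrN ger0_norm ?fine_ge0//.
apply: le_lt_trans HN; rewrite ger0_norm ?fine_ge0//.
have -> : fine (mu (F N)) = stieltjes_tail N%:R.
  by rewrite /stieltjes_tail minEle oppr_le0 ler0n.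
apply: stieltjes_tail_nincr; near: r; exact: nbhs_pinfty_ge.
Unshelve. all: by end_near. Qed.

Lemma stieltjes_integrable (u : R -> R) : continuous u ->
  [bounded u s | s in `]-oo, 0]%classic] ->
  mu.-integrable `]-oo, 0%R] (EFin \o u).
Proof.
move=> cu bu; apply: measurable_bounded_integrable => //.
- exact: stieltjes_mass_lty.
- by apply: measurable_funTS; apply: continuous_measurable_fun.
Qed.

(** The error is [c] on the whole history, at total mass at most 1, plus [C] on the part older than
    [r], at the price of the tail mass only. A merely bounded remote past thus becomes negligible as
    [r] grows. *)
Lemma stieltjes_integral_dist (u v : R -> R) (c C r : R) :
  continuous u -> continuous v ->
  [bounded u s | s in `]-oo, 0]%classic] ->
  [bounded v s | s in `]-oo, 0]%classic] ->
  0 <= c -> 0 <= C ->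
  (forall s, s <= 0 -> `|u s - v s| <= c + C * (s <= - r)%R%:R) ->
  `|stieltjes_integral eta u - stieltjes_integral eta v| <=
    c + C * stieltjes_tail r.
Proof.
move=> cu cv bu bv c0 C0 uv.
have iu := stieltjes_integrable cu bu; have iv := stieltjes_integrable cv bv.
pose A := `]-oo, Num.min (- r) 0]%classic.
have mA : measurable A by exact: measurable_itv.
have A0 : A `<=` `]-oo, 0].
  by move=> s; rewrite /A /= !in_itv/= le_min => /andP[].
have mfin : (mu `]-oo, 0%R] < +oo)%E.
  exact: stieltjes_mass_lty.
have iA : mu.-integrable `]-oo, 0%R] (EFin \o \1_A).
  apply: measurable_bounded_integrable => //.
  exists 1; split; rewrite ?num_real// => M M1 s _.
  by rewrite /= indicE; case: (_ \in _); rewrite ?normr1 ?normr0 ltW// (lt_trans _ M1).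
have ic (k : R) : mu.-integrable `]-oo, 0%R] (EFin \o cst k).
  apply: measurable_bounded_integrable => //.
  by exists `|k|; split; rewrite ?num_real// => M kM s _ /=; apply: ltW.
have iCA : mu.-integrable `]-oo, 0%R] (EFin \o (fun s => C * \1_A s)).
  rewrite (_ : _ \o _ = (fun s => C%:E * (EFin \o \1_A) s)%E); last by apply/funext.
  exact: integrableZl.
rewrite /stieltjes_integral -RintegralB//.
apply: (le_trans (le_normr_Rintegral _ _)) => //.
  exact: (integrableB _ iu iv).
apply: (@le_trans _ _ (\int[mu]_(s in `]-oo, 0%R]) (c + C * \1_A s))).
  apply: le_Rintegral => //.
  - rewrite (_ : _ \o _ = abse \o ((EFin \o u) \- (EFin \o v))%E); last by apply/funext.
    by apply: integrable_abse; apply: integrableB.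
  - rewrite (_ : _ \o _ =
        ((EFin \o cst c) \+ (EFin \o (fun s => C * \1_A s)%R))%E); last exact/funext.
    exact: integrableD.
  - move=> s s0; apply: (le_trans (uv _ _)); first by move: s0; rewrite /= in_itv.
    rewrite lerD2l ler_wpM2l// indicE mem_setE/= in_itv/= le_min.
    by move: s0; rewrite /= in_itv/= => ->; rewrite andbT.
rewrite RintegralD//.
rewrite Rintegral_cst//.
have -> : \int[mu]_(x in `]-oo, 0%R]) (C * \1_A x) = C * \int[mu]_(x in `]-oo, 0%R]) (\1_A x).
  exact: RintegralZl.
rewrite lerD//.
  by rewrite ler_piMr// stieltjes_mass_le1.
- rewrite ler_wpM2l// /Rintegral integral_indic//.
  by rewrite (setIidl A0).
exact: ic.
Qed.

End stieltjes.

(** * Barriers for functions with one-sided increment bounds *)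

Section real_induction.
Context {R : realType}.

(** This replaces the first exit time of a continuous function. The infimum of the set of failures
    is itself not a failure, by closedness from the left, and openness to the right then keeps
    failures away from it. *)
Lemma real_induction (Q : R -> Prop) (T : R) :
  Q T ->
  (forall t, T < t -> (forall s, T <= s < t -> Q s) -> Q t) ->
  (forall t, T <= t -> (forall s, T <= s <= t -> Q s) ->
     \forall s \near t^'+, Q s) ->
  forall t, T <= t -> Q t.
Proof.
move=> QT Qclosed Qopen t Tt; apply: contrapT => nQt.
pose N := [set s | T <= s /\ ~ Q s].
have iN : has_inf N by split; [exists t|exists T => s []].
have TN : T <= inf N by apply: lb_le_inf; [case: iN|move=> s []].
have Qlt s : T <= s < inf N -> Q s.
  move=> /andP[Ts sN]; apply: contrapT => nQs.
  by move: sN; rewrite ltNge => /negP; apply; apply: ge_inf; [case: iN|].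
have Qle s : T <= s <= inf N -> Q s.
  move=> /andP[Ts]; rewrite le_eqVlt => /predU1P[->|sN]; last exact/Qlt/andP.
  move: TN; rewrite le_eqVlt => /predU1P[<-//|TN]; exact: Qclosed.
have [e /= e0 eQ] := Qopen _ TN Qle.
have [s [Ts nQs] sN] := inf_adherent e0 iN.
have Ns : inf N <= s by apply: ge_inf; [case: iN|].
apply: nQs; move: Ns; rewrite le_eqVlt => /predU1P[<-|Ns].
  by apply: Qle; rewrite TN lexx.
by apply: eQ => //=; rewrite ltr0_norm ?subr_lt0// opprB ltrBlDl.
Qed.

(* The two increment conditions allow Z to jump downwards; no continuity of Z
   is required. *)
Lemma barrier (K : finType) (Z D m : K -> R -> R) (e : K -> R) (T : R) :
  (forall k t, T <= t -> 0 < m k t) ->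
  (forall k s t, T <= s -> s <= t -> m k s - e k * (t - s) <= m k t) ->
  (forall k t, T < t -> forall d, 0 < d ->
     \forall s \near t^'-, Z k t <= Num.max 0 (Z k s + d)) ->
  (forall k t, T <= t -> forall d, 0 < d ->
     \forall s \near t^'+,
       Z k s <= Num.max 0 (Z k t + (D k t + d) * (s - t))) ->
  (forall k, Z k T <= m k T) ->
  (forall t, T <= t -> (forall s k, T <= s <= t -> Z k s <= m k s) ->
     forall k, Z k t = m k t -> D k t < - e k) ->
  forall t, T <= t -> forall k, Z k t <= m k t.
Proof.
move=> m0 mslope Zleft Zright ZT ZD.
apply: real_induction => [|t Tt Zm k|t Tt Zm]//.
- rewrite leNgt; apply/negP => mZ.
  (* A third of the overshoot: one third is lost in the left increment of [Z] and less than one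
     third in the variation of the barrier, so [Z k s] would already exceed [m k s]. *)
  set d := (Z k t - m k t) / 3.
  have d0 : 0 < d by rewrite divr_gt0 ?subr_gt0.
  have [s] : exists s, [/\ T <= s, s < t, (`|e k| + 1) * (t - s) < d &
      Z k t <= Num.max 0 (Z k s + d)].
    apply: (@filter_ex _ t^'-); near=> s; split.
    + by near: s; exact: nbhs_left_ge.
    + by near: s; exact: nbhs_left_lt.
    + rewrite mulrC -ltr_pdivlMr ?ltr_wpDl//; near: s.
      by apply: nbhs_left_ltBl; rewrite divr_gt0 ?ltr_wpDl.
    + by near: s; exact: Zleft.
  case=> Ts st es; rewrite le_max => /orP[|Zs].
    by rewrite leNgt (lt_trans _ mZ)// m0// ltW.
  have := Zm s; rewrite Ts st => /(_ isT k) Zms.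
  have := mslope k s t Ts (ltW st) => ms.
  have : e k * (t - s) <= (`|e k| + 1) * (t - s).
    by rewrite ler_wpM2r ?subr_ge0 ?(ltW st)// (le_trans (ler_norm _))// lerDl.
  move=> ets; have dE : 3 * d = Z k t - m k t by rewrite mulrC /d divfK.
  lra.
- apply: filter_forall => k.
  have := Zm t; rewrite lexx Tt => /(_ isT) Zmt.
  (* On the barrier, the strict bound on [D] keeps [Z] below the steepest descent allowed to [m].
     Strictly below it, the distance to the barrier absorbs any finite relative slope for a short
     time. *)
  have [Zeq|Zne] := eqVneq (Z k t) (m k t).
    have Dk : D k t < - e k by apply: ZD => // s j Ts; exact: Zm.
    have d0 : 0 < - e k - D k t by rewrite subr_gt0.
    have := Zright k t Tt _ d0; apply: filterS2 (nbhs_right_gt t) => s ts Zs.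
    apply: (le_trans Zs); rewrite ge_max ltW ?m0 ?(le_trans Tt (ltW ts))//=.
    rewrite [D k t + _]addrC subrK Zeq mulNr; exact/mslope/ltW.
  have Zlt : 0 < m k t - Z k t by rewrite subr_gt0 lt_neqAle Zne Zmt.
  have := Zright k t Tt _ ltr01.
  set c := `|D k t + 1 + e k| + 1.
  have c0 : 0 < c by rewrite ltr_wpDl.
  have := @nbhs_right_ltDr _ t _ (divr_gt0 Zlt c0).
  apply: filterS3 (nbhs_right_gt t) => s ts.
  rewrite ltr_pdivlMr// => cs Zs.
  apply: (le_trans Zs); rewrite ge_max ltW ?m0 ?(le_trans Tt (ltW ts))//=.
  apply: le_trans (mslope k t s Tt (ltW ts)).
  have : (D k t + 1 + e k) * (s - t) <= c * (s - t).
    by rewrite ler_wpM2r ?subr_ge0 ?(ltW ts)// (le_trans (ler_norm _))// lerDl.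
  lra.
Unshelve. all: by end_near. Qed.

End real_induction.

(** * Primitives of continuous functions on the whole line *)

Section primitive.
Context {R : realType}.

(* As f vanishes on the left of 0, its integral from -1 is constant there, so
   the base point -1 causes no loss of differentiability. *)
Lemma primitive_half (f : R -> R) : continuous f ->
  (forall u, u <= 0 -> f u = 0) ->
  exists F : R -> R, forall v : R, is_derive v 1 F (f v).
Proof.
move=> cf f0.
pose mu := @lebesgue_measure R.
exists (fun v => \int[mu]_(u in `[-1, v]) f u) => v.
have [v0|v0] := ltP v 0.
  have F0 : {near v, cst 0 =1 (fun v => \int[mu]_(u in `[-1, v]) f u)}.
    near=> y; rewrite /= [RHS](_ : _ = \int[mu]_(u in `[-1, y]) 0).
      by rewrite Rintegral_cst// mul0r.
    apply: eq_Rintegral => u; rewrite inE/= in_itv/= => /andP[_ uy].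
    apply: f0; apply: (le_trans uy); apply: ltW; near: y.
    exact: lt_nbhsl.
  rewrite f0 ?ltW//.
  apply: (near_eq_is_derive F0).
have fi : mu.-integrable `[-1, (v + 1)] (EFin \o f).
  apply: continuous_compact_integrable; first exact: segment_compact.
  exact: continuous_subspaceT.
have v1 : -1 < v by rewrite (lt_le_trans _ v0)// ltrN10.
have [dF eF] := @continuous_FTC1_closed _ f (-1) v (v + 1) (ltr_pwDr ltr01 (lexx _)) fi v1 (cf v).
apply: DeriveDef => //.
by rewrite -derive1E eF.
Unshelve. all: by end_near. Qed.

(** [f - f 0] is the sum of a function vanishing on the left of 0 and one vanishing on the right;
    the second is reflected, so that both fall under the half-line case. *)
Lemma primitive_exists (f : R -> R) : continuous f ->
  exists F : R -> R, forall v : R, is_derive v 1 F (f v).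
Proof.
move=> cf.
have [|u u0|P dP] := @primitive_half (fun u => f (Num.max u 0) - f 0).
- move=> u; apply: continuousB; last exact: cst_continuous.
  apply: continuous_comp; last exact: cf.
  by apply: continuous_max; [exact: cvg_id|exact: cvg_cst].
- by rewrite (max_idPr u0) subrr.
have [|u u0|Q dQ] := @primitive_half (fun u => f (- Num.max u 0) - f 0).
- move=> u; apply: continuousB; last exact: cst_continuous.
  apply: continuous_comp; last exact: cf.
  apply: continuousN.
  by apply: continuous_max; [exact: cvg_id|exact: cvg_cst].
- by rewrite (max_idPr u0) oppr0 subrr.
exists (P - (Q \o -%R) + f 0 \*: id) => v.
have dQN := @is_derive1_comp _ Q -%R v _ _ (dQ (- v)) (is_deriveNid v 1).
have dF := is_deriveD (is_deriveB (dP v) dQN) (is_deriveZ (f 0) (is_derive_id v 1)).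
apply: (is_derive_eq dF).
rewrite mulrN1 opprK [_ *: _]mulr1.
have [v0|v0] := leP v 0; last first.
  by rewrite (@max_r _ _ (- v)) ?oppr_le0 ?ltW// oppr0; ring.
by rewrite (@max_l _ _ (- v)) ?oppr_ge0// opprK; ring.
Qed.

End primitive.

(** * The change of variables *)

(** The difference quotient of [F], completed by the derivative at [x t], is continuous there. This
    covers the instants [s] with [x s = x t], at which dividing by [x s - x t] is meaningless. *)
Lemma caratheodory_right_chain (R : realType) (F x : R -> R) (t p q : R) :
  is_derive (x t) 1 F p -> {for t, continuous x} ->
  (x s - x t) / (s - t) @[s --> t^'+] --> q ->
  (F (x s) - F (x t)) / (s - t) @[s --> t^'+] --> p * q.
Proof.
move=> [dF pE] cx xq.
pose slope v := if v == x t then p else (F v - F (x t)) / (v - x t).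
have slope_cont : slope v @[v --> x t] --> p.
  apply/cvgrPdist_lt => e e0.
  move: dF => /cvgrPdist_lt/(_ _ e0); rewrite -/(derive _ _ _) pE => -[r /= r0 rF].
  exists r => //= v vr; rewrite /slope; case: eqP => [_|/eqP vx].
    by rewrite subrr normr0.
  have := rF (v - x t); rewrite /= sub0r normrN -normrN opprB => /(_ vr).
  rewrite subr_eq0 => /(_ vx).
  by rewrite [_ *: 1]mulr1 subrK [_ *: _]mulrC.
have H : slope (x s) @[s --> t^'+] --> p.
  by apply: cvg_comp slope_cont; apply: cvg_at_right_filter.
have H2 : slope (x s) * ((x s - x t) / (s - t)) @[s --> t^'+] --> p * q by exact: cvgM.
apply: cvg_trans H2; apply: near_eq_cvg; near=> s => /=.
rewrite /slope; case: eqP => [->|/eqP xs]; first by rewrite !subrr mul0r mulr0.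
by rewrite mulrA divfK ?subr_eq0.
Unshelve. all: by end_near. Qed.

Section transport.
Context {R : realType} (phi Phi : R -> R -> R) (B : R -> R) (T lo up : R).
Hypothesis Phi_d : forall t (u : R), T <= t -> is_derive u 1 (Phi t) (phi t u).
Hypothesis lo0 : 0 < lo.
Hypothesis phi_bd : forall t u, T <= t -> lo <= phi t u <= up.
Hypothesis phi_decr : forall s t u mu, T <= s -> s <= t ->
  (forall r, s <= r <= t -> mu <= B r) -> phi t u - phi s u <= - mu * (t - s).
Hypothesis B_cont : forall t, T <= t -> {for t, continuous B}.

Let Phi_cont t : T <= t -> continuous (Phi t).
Proof.
move=> Tt u; have [dP _] := Phi_d u Tt.
exact/differentiable_continuous/derivable1_diffP.
Qed.

Lemma transport_bounds t u v : T <= t -> v <= u ->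
  lo * (u - v) <= Phi t u - Phi t v <= up * (u - v).
Proof.
move=> Tt vu.
have [c _ ->] := @MVT_segment R (Phi t) (phi t) v u vu
  (fun c _ => Phi_d c Tt) (continuous_subspaceT (Phi_cont Tt)).
have /andP[loc cup] := phi_bd c Tt.
by rewrite !ler_wpM2r ?subr_ge0.
Qed.

Lemma transport_norm t u v : T <= t ->
  lo * `|u - v| <= `|Phi t u - Phi t v| <= up * `|u - v|.
Proof.
move=> Tt; wlog vu : u v / v <= u.
  move=> H; have [/H//|/ltW/H] := leP v u.
  by rewrite distrC (distrC (Phi t v)).
have /andP[h1 h2] := transport_bounds Tt vu.
have d0 : 0 <= u - v by rewrite subr_ge0.
rewrite !ger0_norm ?h1 ?h2//; apply: le_trans h1.
by rewrite mulr_ge0// ltW.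
Qed.

Lemma transport_gt0 t u v : T <= t -> 0 < Phi t u - Phi t v -> v < u.
Proof.
move=> Tt; rewrite !ltNge; apply: contra => uv.
have /andP[+ _] := transport_bounds Tt uv.
move=> h; rewrite -(opprB (Phi t v)) oppr_le0; apply: le_trans h.
by rewrite mulr_ge0 ?subr_ge0// ltW.
Qed.

(** The mean value theorem is applied in space, to [Phi t - Phi s], whose derivative is
    [phi t - phi s]; no time derivative of [Phi] is taken. With phi = 1 / a, [phi_decr] is the
    integrated form of a lower bound on (da/dt) / a^2. *)
Lemma transport_time s t u v mu : T <= s -> s <= t -> v <= u ->
  (forall r, s <= r <= t -> mu <= B r) ->
  (Phi t u - Phi t v) - (Phi s u - Phi s v) <= - mu * (t - s) * (u - v).
Proof.
move=> Ts st vu muB; have Tt := le_trans Ts st.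
have cd : continuous (Phi t - Phi s).
  by move=> w; apply: continuousB; exact: Phi_cont.
have [c _ E] := @MVT_segment R (Phi t - Phi s) (fun w => phi t w - phi s w) v u vu
  (fun c _ => is_deriveB (Phi_d c Tt) (Phi_d c Ts)) (continuous_subspaceT cd).
have -> : (Phi t u - Phi t v) - (Phi s u - Phi s v) =
    (Phi t - Phi s) u - (Phi t - Phi s) v.
  by rewrite !fctE; ring.
by rewrite E ler_wpM2r ?subr_ge0// phi_decr.
Qed.

Variables x y : R -> R.
Hypothesis x_cont : continuous x.
Hypothesis y_cont : continuous y.
Let Z t := Phi t (x t) - Phi t (y t).

(** [Z t - Z s] splits into a change of time at the fixed points [x t], [y t] and a change of points
    at the fixed time [s]. The first part is controlled only from above and only when [y t <= x t],
    which explains the maximum with 0; the second is small by continuity and the slope bound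
    [up]. *)
Lemma transport_left t : T < t -> forall d, 0 < d ->
  \forall s \near t^'-, Z t <= Num.max 0 (Z s + d).
Proof.
move=> Tt d d0.
have lim : (up * `|x t - x s| + up * `|y t - y s|) + (`|B t| + 1) * `|x t - y t| * (t - s)
    @[s --> t^'-] -->
    (up * `|x t - x t| + up * `|y t - y t|) + (`|B t| + 1) * `|x t - y t| * (t - t).
  apply: cvg_at_left_filter.
  have cn (z : R -> R) : continuous z -> up * `|z t - z s| @[s --> t] --> up * `|z t - z t|.
    move=> cz; apply: cvgM; first exact: cvg_cst.
    by apply: cvg_norm; apply: cvgB; [exact: cvg_cst|exact: cz].
  apply: cvgD; first by apply: cvgD; exact: cn.
  by apply: cvgM; [exact: cvg_cst|apply: cvgB; [exact: cvg_cst|exact: cvg_id]].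
rewrite !subrr normr0 !mulr0 !addr0 in lim.
have lt_near := cvgr_lt _ lim _ d0.
have Bnear : \forall r \near t, - (`|B t| + 1) <= B r.
  apply: (cvgr_ge _ (B_cont (ltW Tt))).
  by have := ler_norm (- B t); rewrite normrN; lra.
have [r /= r0 rB] := Bnear.
near=> s.
have st : s < t by near: s; exact: nbhs_left_lt.
have sr : t - s < r by near: s; exact: nbhs_left_ltBl.
have Ts : T <= s by near: s; exact: nbhs_left_ge.
rewrite le_max; have [//|Zt0/=] := leP (Z t) 0.
have yx := transport_gt0 (ltW Tt) Zt0.
have := @transport_time s t (x t) (y t) (- (`|B t| + 1)) Ts (ltW st) (ltW yx).
have h : forall q, s <= q <= t -> - (`|B t| + 1) <= B q.
  move=> q /andP[sq qt]; apply: rB => /=.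
  by rewrite ger0_norm ?subr_ge0// (le_lt_trans _ sr)// lerB.
move=> /(_ h).
have : up * `|x t - x s| + up * `|y t - y s| + (`|B t| + 1) * `|x t - y t| * (t - s) < d.
  by near: s; exact: lt_near.
have /andP[_] := @transport_norm s (x t) (x s) Ts.
have /andP[_] := @transport_norm s (y t) (y s) Ts.
have := ler_norm (Phi s (x t) - Phi s (x s)).
have := ler_norm (- (Phi s (y t) - Phi s (y s))); rewrite normrN.
rewrite (gtr0_norm (_ : 0 < x t - y t)) ?subr_gt0// /Z opprK.
by move=> *; lra.
Unshelve. all: by end_near. Qed.

(** The split is now in the other order. Points move first, at the fixed time [t], where the chain
    rule applies and [phi] cancels, leaving [X - Y]; time moves next, at the fixed points [x s],
    [y s], and contributes the term in [B]. *)
Lemma transport_right t X Y : T <= t ->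
  (x s - x t) / (s - t) @[s --> t^'+] --> (phi t (x t))^-1 * X ->
  (y s - y t) / (s - t) @[s --> t^'+] --> (phi t (y t))^-1 * Y ->
  forall d, 0 < d ->
  \forall s \near t^'+, Z s <=
    Num.max 0 (Z t + (X - Y - B t * (x t - y t) + d) * (s - t)).
Proof.
move=> Tt dx dy d d0.
have phi0 u : phi t u != 0.
  have /andP[+ _] := phi_bd u Tt; move=> /(lt_le_trans lo0) h.
  by rewrite gt_eqF.
have dPx := caratheodory_right_chain (Phi_d (x t) Tt) (@x_cont t) dx.
have dPy := caratheodory_right_chain (Phi_d (y t) Tt) (@y_cont t) dy.
rewrite mulrA divff// mul1r in dPx; rewrite mulrA divff// mul1r in dPy.
(* [e] is the loss allowed when [B] is replaced by the lower bound [B t - e] near [t]; its cost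
   [e * (x t - y t)] must stay below [d]. The added 1 covers [x t = y t]. *)
set e := d / (2 * (`|x t - y t| + 1)).
have n0 : 0 < `|x t - y t| + 1 by rewrite ltr_wpDl.
have e0 : 0 < e by rewrite divr_gt0 ?mulr_gt0.
have ed : e * `|x t - y t| < d.
  rewrite /e mulrAC ltr_pdivrMr ?mulr_gt0// ltr_pM2l//.
  by have := normr_ge0 (x t - y t); lra.
have lim : (Phi t (x s) - Phi t (x t)) / (s - t) -
    (Phi t (y s) - Phi t (y t)) / (s - t) - (B t - e) * (x s - y s)
    @[s --> t^'+] --> X - Y - (B t - e) * (x t - y t).
  apply: cvgB; first exact: cvgB.
  apply: cvgM; first exact: cvg_cst.
  by apply: cvgB; apply: cvg_at_right_filter; [exact: x_cont|exact: y_cont].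
have /(cvgr_lt _ lim) lt_near : X - Y - (B t - e) * (x t - y t) <
    X - Y - B t * (x t - y t) + d.
  have : e * (x t - y t) < d by rewrite (le_lt_trans _ ed)// ler_wpM2l ?ler_norm// ltW.
  by move=> h; lra.
have Bnear : \forall r \near t, B t - e <= B r.
  by apply: (cvgr_ge _ (B_cont Tt)); rewrite ltrBlDr ltrDl.
have [r /= r0 rB] := Bnear.
near=> s.
have ts : t < s by near: s; exact: nbhs_right_gt.
have sr : s - t < r by near: s; exact: nbhs_right_ltDr.
have Ts := le_trans Tt (ltW ts).
rewrite le_max; have [//|Zs0/=] := leP (Z s) 0.
have yx := transport_gt0 Ts Zs0.
have := @transport_time t s (x s) (y s) (B t - e) Tt (ltW ts) (ltW yx).
have h : forall q, t <= q <= s -> B t - e <= B q.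
  move=> q /andP[tq qs]; apply: rB => /=.
  by rewrite ler0_norm ?subr_le0// opprB (le_lt_trans _ sr)// lerB.
move=> /(_ h).
have : (Phi t (x s) - Phi t (x t)) / (s - t) -
    (Phi t (y s) - Phi t (y t)) / (s - t) - (B t - e) * (x s - y s) <
    X - Y - B t * (x t - y t) + d by near: s; exact: lt_near.
have st0 : 0 < s - t by rewrite subr_gt0.
rewrite -(ltr_pM2r st0) mulrBl [in X in X < _]mulrBl !divfK ?gt_eqF// /Z.
by move=> h1 h2; lra.
Unshelve. all: by end_near. Qed.

End transport.

(** * Comparison of two approximate solutions *)

Section comparison.
Context {R : realType} {n P : nat}.
Variables (a b : 'I_n -> R * R -> R) (F : 'I_n -> R * R -> R)
  (c d : 'I_n -> 'I_n -> 'I_n -> 'I_P -> R -> R)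
  (h f : 'I_n -> 'I_n -> 'I_n -> 'I_P -> R * R -> R)
  (tau tau' : 'I_n -> 'I_n -> 'I_P -> R -> R)
  (g g' : 'I_n -> 'I_n -> 'I_P -> R -> R)
  (eta eta' : 'I_n -> 'I_n -> 'I_P -> bounded_nondecreasing R)
  (I : 'I_n -> R -> R).

Definition delayed_input (x : R -> 'rV[R]_n) (i : 'I_n) (t : R) : R * R :=
  (\sum_(p < P) \sum_(j < n) \sum_(l < n)
     c i j l p t *
     h i j l p (x (t - tau i j p t) 0 j, x (t - tau' i l p t) 0 l),
   \sum_(p < P) \sum_(j < n) \sum_(l < n)
     d i j l p t *
     f i j l p
       (stieltjes_integral (eta i j p) (fun s => g i j p (x (t + s) 0 j)),
        stieltjes_integral (eta' i l p)
          (fun s => g' i l p (x (t + s) 0 l)))).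

Variables (gamma1 gamma2 mu1 mu2 : 'I_n -> 'I_n -> 'I_n -> 'I_P -> R)
  (xi xi' : 'I_n -> 'I_n -> 'I_P -> R) (zeta sigma : 'I_n -> R)
  (a_low a_up w : 'I_n -> R).

(** The sum in (vii): the Lipschitz constant of the i-th nonlinear term when the j-th coordinate of
    the history is measured in units of [a_up j * w j] and the result in units of [w i]. *)
Definition gain (i : 'I_n) (t : R) : R :=
  \sum_(p < P) \sum_(j < n) \sum_(l < n)
    (zeta i * `|c i j l p t| *
       (a_up j * (w j / w i) * gamma1 i j l p
        + a_up l * (w l / w i) * gamma2 i j l p)
     + sigma i * `|d i j l p t| *
       (a_up j * (w j / w i) * xi i j p * mu1 i j l p
        + a_up l * (w l / w i) * xi' i l p * mu2 i j l p)).

Hypothesis gamma1_gt0 : forall i j l p, 0 < gamma1 i j l p.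
Hypothesis gamma2_gt0 : forall i j l p, 0 < gamma2 i j l p.
Hypothesis mu1_gt0 : forall i j l p, 0 < mu1 i j l p.
Hypothesis mu2_gt0 : forall i j l p, 0 < mu2 i j l p.
Hypothesis h_lip : forall i j l p u1 u2 v1 v2,
  `|h i j l p (u1, u2) - h i j l p (v1, v2)|
    <= gamma1 i j l p * `|u1 - v1| + gamma2 i j l p * `|u2 - v2|.
Hypothesis f_lip : forall i j l p u1 u2 v1 v2,
  `|f i j l p (u1, u2) - f i j l p (v1, v2)|
    <= mu1 i j l p * `|u1 - v1| + mu2 i j l p * `|u2 - v2|.
Hypothesis xi_gt0 : forall i j p, 0 < xi i j p.
Hypothesis xi'_gt0 : forall i j p, 0 < xi' i j p.
Hypothesis zeta_gt0 : forall i, 0 < zeta i.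
Hypothesis sigma_gt0 : forall i, 0 < sigma i.
Hypothesis g_lip : forall i j p u v, `|g i j p u - g i j p v| <= xi i j p * `|u - v|.
Hypothesis g'_lip : forall i j p u v, `|g' i j p u - g' i j p v| <= xi' i j p * `|u - v|.
Hypothesis F_lip : forall i u1 u2 v1 v2,
  `|F i (u1, u2) - F i (v1, v2)| <= zeta i * `|u1 - v1| + sigma i * `|u2 - v2|.
Hypothesis a_up_gt0 : forall i, 0 < a_up i.
Hypothesis a_low_gt0 : forall i, 0 < a_low i.
Hypothesis w_gt0 : forall i, 0 < w i.
Hypothesis eta_mass : forall i j p,
  eta i j p 0 - lim (eta i j p s @[s --> -oo]) = 1.
Hypothesis eta'_mass : forall i l p,
  eta' i l p 0 - lim (eta' i l p s @[s --> -oo]) = 1.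
Hypothesis g_cont : forall i j p, continuous (g i j p).
Hypothesis g'_cont : forall i l p, continuous (g' i l p).

Lemma gain_ge0 i t : 0 <= gain i t.
Proof.
apply: sumr_ge0 => p _; apply: sumr_ge0 => j _; apply: sumr_ge0 => l _.
have := (gamma1_gt0 i j l p, gamma2_gt0 i j l p, mu1_gt0 i j l p, mu2_gt0 i j l p).
have := (zeta_gt0 i, sigma_gt0 i, a_up_gt0 j, a_up_gt0 l, xi_gt0 i j p, xi'_gt0 i l p).
have := (w_gt0 i, w_gt0 j, w_gt0 l).
move=> [[wi wj] wl] [[[[[z s] uj] ul] x] x'] [[[g1 g2] m1] m2].
by rewrite addr_ge0// mulr_ge0 ?addr_ge0// ?mulr_ge0 ?invr_ge0// ltW.
Qed.

Lemma ler_dist_sum3 (q : 'I_n -> 'I_n -> 'I_P -> R) (H K G : 'I_n -> 'I_n -> 'I_P -> R) :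
  (forall j l p, `|H j l p - K j l p| <= G j l p) ->
  `|\sum_(p < P) \sum_(j < n) \sum_(l < n) q j l p * H j l p -
    \sum_(p < P) \sum_(j < n) \sum_(l < n) q j l p * K j l p| <=
  \sum_(p < P) \sum_(j < n) \sum_(l < n) `|q j l p| * G j l p.
Proof.
move=> HKG; rewrite -sumrB (le_trans (ler_norm_sum _ _ _))// ler_sum// => p _.
rewrite -sumrB (le_trans (ler_norm_sum _ _ _))// ler_sum// => j _.
rewrite -sumrB (le_trans (ler_norm_sum _ _ _))// ler_sum// => l _.
by rewrite -mulrBr normrM ler_wpM2l.
Qed.

(** The bounds on the integrals are hypotheses because they are reached in two ways: from a uniform
    bound on the whole past, or from a recent bound plus a small tail. *)
Lemma delayed_input_lip (x y : R -> 'rV[R]_n) i t Lam :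
  (forall j p, `|x (t - tau i j p t) 0 j - y (t - tau i j p t) 0 j| <= a_up j * w j * Lam) ->
  (forall l p, `|x (t - tau' i l p t) 0 l - y (t - tau' i l p t) 0 l| <= a_up l * w l * Lam) ->
  (forall j p, `|stieltjes_integral (eta i j p) (fun s => g i j p (x (t + s) 0 j)) -
      stieltjes_integral (eta i j p) (fun s => g i j p (y (t + s) 0 j))|
    <= xi i j p * (a_up j * w j * Lam)) ->
  (forall l p, `|stieltjes_integral (eta' i l p) (fun s => g' i l p (x (t + s) 0 l)) -
      stieltjes_integral (eta' i l p) (fun s => g' i l p (y (t + s) 0 l))|
    <= xi' i l p * (a_up l * w l * Lam)) ->
  `|F i (delayed_input x i t) - F i (delayed_input y i t)| <= w i * gain i t * Lam.
Proof.
move=> H1 H2 H3 H4; apply: (le_trans (F_lip _ _ _ _ _)).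
apply: (@le_trans _ _ (zeta i * (\sum_(p < P) \sum_(j < n) \sum_(l < n) `|c i j l p t| *
    (gamma1 i j l p * (a_up j * w j * Lam) + gamma2 i j l p * (a_up l * w l * Lam))) +
  sigma i * (\sum_(p < P) \sum_(j < n) \sum_(l < n) `|d i j l p t| *
    (mu1 i j l p * (xi i j p * (a_up j * w j * Lam)) +
     mu2 i j l p * (xi' i l p * (a_up l * w l * Lam)))))).
  apply: lerD.
    rewrite ler_wpM2l ?(ltW (zeta_gt0 i))//.
    apply: (@ler_dist_sum3 (fun j l p => c i j l p t)) => j l p.
    apply: (le_trans (h_lip _ _ _ _ _ _ _ _)).
    by rewrite lerD// ler_wpM2l// ltW.
  rewrite ler_wpM2l ?(ltW (sigma_gt0 i))//.
  apply: (@ler_dist_sum3 (fun j l p => d i j l p t)) => j l p.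
  apply: (le_trans (f_lip _ _ _ _ _ _ _ _)).
  by rewrite lerD// ler_wpM2l// ltW.
rewrite le_eqVlt; apply/orP; left; apply/eqP.
rewrite /gain !mulr_sumr mulr_suml -big_split; apply: eq_bigr => p _ /=.
rewrite !mulr_sumr mulr_suml -big_split; apply: eq_bigr => j _ /=.
rewrite !mulr_sumr mulr_suml -big_split; apply: eq_bigr => l _ /=.
by have /lt0r_neq0 := w_gt0 i; move=> ?; field.
Qed.

(** What a bounded initial condition and continuity give before any global bound is known; it
    suffices to make the integrals over the history finite. *)
Definition past_bounded (x : R -> 'rV[R]_n) :=
  forall t, exists M, forall s j, s <= t -> `|x s 0 j| <= M.

Lemma stieltjes_lip_dist (e : bounded_nondecreasing R) (k : R -> R) (L : R)
    (x y : R -> 'rV[R]_n) j t C0 C1 r :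
  e 0 - lim (e s @[s --> -oo]) = 1 ->
  continuous k -> 0 < L -> (forall u v : R, `|k u - k v| <= L * `|u - v|) ->
  continuous (fun s => x s 0 j) -> continuous (fun s => y s 0 j) ->
  past_bounded x -> past_bounded y -> 0 <= C0 -> 0 <= C1 ->
  (forall s, s <= 0 -> `|x (t + s) 0 j - y (t + s) 0 j| <= C0 + C1 * (s <= - r)%R%:R) ->
  `|stieltjes_integral e (fun s => k (x (t + s) 0 j)) -
    stieltjes_integral e (fun s => k (y (t + s) 0 j))| <= L * C0 + L * C1 * stieltjes_tail e r.
Proof.
move=> em kc L0 kL cx cy bx by_ C00 C10 xy.
have cc (z : R -> 'rV[R]_n) : continuous (fun s => z s 0 j) ->
    continuous (fun s => k (z (t + s) 0 j)).
  move=> cz s; apply: (@continuous_comp _ _ _ (fun s => z (t + s) 0 j) k); last exact: kc.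
  apply: (@continuous_comp _ _ _ (fun s => t + s) (fun s => z s 0 j)); last exact: cz.
  by apply: cvgD; [exact: cvg_cst|exact: cvg_id].
have bb (z : R -> 'rV[R]_n) : past_bounded z ->
    [bounded k (z (t + s) 0 j) | s in `]-oo, 0]%classic].
  move=> /(_ t)[M zM]; exists (`|k 0| + L * M); split; first exact: num_real.
  move=> N MN s /=; rewrite in_itv/= => s0; apply: ltW; apply: le_lt_trans MN.
  have := kL (z (t + s) 0 j) 0; rewrite subr0 => kz.
  have := zM (t + s) j; rewrite gerDl => /(_ s0) zMs.
  rewrite -lerBlDl; apply: le_trans (le_trans (lerB_dist _ _) kz) _.
  by rewrite ler_wpM2l// ltW.
apply: stieltjes_integral_dist => //; [exact: cc|exact: cc|exact: bb|exact: bb| | |].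
- by rewrite mulr_ge0// ltW.
- by rewrite mulr_ge0// ltW.
- move=> s s0; apply: (le_trans (kL _ _)).
  by rewrite -mulrA -mulrDr ler_wpM2l ?(ltW L0)// xy.
Qed.

Variables (Phi : 'I_n -> R -> R -> R) (B beta : 'I_n -> R -> R) (T eps : R).
Hypothesis eps_gt0 : 0 < eps.
Hypothesis a_bounds : forall i t v, T <= t -> a_low i <= a i (t, v) <= a_up i.
Hypothesis Phi_d : forall i t (u : R), T <= t -> is_derive u 1 (Phi i t) (a i (t, u))^-1.
Hypothesis a_inv_decr : forall i s t u mu, T <= s -> s <= t ->
  (forall q, s <= q <= t -> mu <= B i q) ->
  (a i (t, u))^-1 - (a i (s, u))^-1 <= - mu * (t - s).
Hypothesis B_cont : forall i t, T <= t -> {for t, continuous (B i)}.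
Hypothesis b_slope : forall i t u v, T <= t -> u != v ->
  beta i t <= (b i (t, u) - b i (t, v)) / (u - v).
Hypothesis gain_beta : forall i t, T <= t ->
  gain i t + eps <= a_low i * (beta i t + B i t).
Hypothesis tau_ge0 : forall i j p t, T <= t -> 0 <= tau i j p t.
Hypothesis tau'_ge0 : forall i l p t, T <= t -> 0 <= tau' i l p t.

Variables (x y : R -> 'rV[R]_n) (r : 'I_n -> R -> R).
Hypothesis x_cont : forall j, continuous (fun s => x s 0 j).
Hypothesis y_cont : forall j, continuous (fun s => y s 0 j).
Hypothesis x_past : past_bounded x.
Hypothesis y_past : past_bounded y.
Hypothesis x_der : forall i t, T <= t ->
  (x s 0 i - x t 0 i) / (s - t) @[s --> t^'+] -->
  a i (t, x t 0 i) * (- b i (t, x t 0 i) + F i (delayed_input x i t) + I i t).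
Hypothesis y_der : forall i t, T <= t ->
  (y s 0 i - y t 0 i) / (s - t) @[s --> t^'+] -->
  a i (t, y t 0 i) *
    (- b i (t, y t 0 i) + F i (delayed_input y i t) + I i t + r i t).

Let gap i t := Phi i t (x t 0 i) - Phi i t (y t 0 i).

Let a_gt0 i t v : T <= t -> 0 < a i (t, v).
Proof. by move=> /(a_bounds i v)/andP[+ _]; exact: lt_le_trans. Qed.

Let a_inv_bounds i t v : T <= t -> (a_up i)^-1 <= (a i (t, v))^-1 <= (a_low i)^-1.
Proof.
move=> Tt; have /andP[h1 h2] := a_bounds i v Tt.
by rewrite !lef_pV2 ?posrE ?h1 ?h2// a_gt0.
Qed.

Let a_up_inv_gt0 i : 0 < (a_up i)^-1. Proof. by rewrite invr_gt0. Qed.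

Lemma dist_le_gap i t : T <= t -> `|x t 0 i - y t 0 i| <= a_up i * `|gap i t|.
Proof.
move=> Tt; have /andP[+ _] := transport_norm (Phi_d i) (a_up_inv_gt0 i) (a_inv_bounds i)
  (x t 0 i) (y t 0 i) Tt.
by rewrite mulrC ler_pdivrMr// mulrC.
Qed.

Lemma gap_le_dist i t : T <= t -> `|gap i t| <= (a_low i)^-1 * `|x t 0 i - y t 0 i|.
Proof.
move=> Tt; have /andP[_] := transport_norm (Phi_d i) (a_up_inv_gt0 i) (a_inv_bounds i)
  (x t 0 i) (y t 0 i) Tt; exact.
Qed.

(** [M] stands for the value of the gap on the barrier. The condition on [M] reflects the slope of
    [Phi], at most [1 / a_low i], and [gain_beta] then converts the damping [(beta + B) * (u - v)]
    into at least [(gain + eps) * M]. *)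
Lemma monotone_drift i t u v rho M : T <= t -> v < u -> M <= (u - v) / a_low i ->
  0 <= M ->
  - b i (t, u) + b i (t, v) + rho - B i t * (u - v) <= rho - (gain i t + eps) * M.
Proof.
move=> Tt vu Mle M0.
have uv0 : 0 < u - v by rewrite subr_gt0.
have := b_slope i Tt (_ : u != v); rewrite gt_eqF// => /(_ isT).
rewrite ler_pdivlMr// => bs.
have := gain_beta i Tt => gb.
have : (gain i t + eps) * M <= (beta i t + B i t) * (u - v).
  apply: (@le_trans _ _ (a_low i * (beta i t + B i t) * ((u - v) / a_low i))).
    apply: ler_pM => //; by rewrite addr_ge0 ?gain_ge0// ltW.
  rewrite le_eqVlt; apply/orP; left; apply/eqP.
  by field; rewrite gt_eqF.
lra.
Qed.

(** Both signs of each gap are fed to [barrier] through the index ['I_n * bool]; the second sign is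
    the first with [x] and [y] exchanged, so the same increment estimates apply. [e] is the speed at
    which the barrier may descend, paid for by the damping. *)
Lemma gap_barrier (m : R -> R) (e T1 : R) : T <= T1 ->
  (forall t, T1 <= t -> 0 < m t) ->
  (forall s t, T1 <= s -> s <= t -> m s - e * (t - s) <= m t) ->
  (forall i, `|gap i T1| <= w i * m T1) ->
  (forall t, T1 <= t -> (forall s i, T1 <= s <= t -> `|gap i s| <= w i * m s) ->
     forall i, `|F i (delayed_input x i t) - F i (delayed_input y i t)| + `|r i t| <
       w i * ((gain i t + eps) * m t - e)) ->
  forall t i, T1 <= t -> `|gap i t| <= w i * m t.
Proof.
move=> TT1 m0 mslope gapT1 defect.
have T1P t : T1 <= t -> T <= t by exact: le_trans.
pose X i t := - b i (t, x t 0 i) + F i (delayed_input x i t) + I i t.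
pose Y i t := - b i (t, y t 0 i) + F i (delayed_input y i t) + I i t + r i t.
pose Z (k : 'I_n * bool) t := if k.2 then gap k.1 t
  else Phi k.1 t (y t 0 k.1) - Phi k.1 t (x t 0 k.1).
pose D (k : 'I_n * bool) t :=
  if k.2 then X k.1 t - Y k.1 t - B k.1 t * (x t 0 k.1 - y t 0 k.1)
  else Y k.1 t - X k.1 t - B k.1 t * (y t 0 k.1 - x t 0 k.1).
have ZE i t s : `|gap i t| <= s <-> forall o, Z (i, o) t <= s.
  rewrite /Z ler_norml; split => [/andP[h1 h2] [|]//=|H].
    by rewrite -opprB lerNl.
  by rewrite (H true) lerNl; have := H false; rewrite /= -[X in X <= _]opprB => ->.
suff H t : T1 <= t -> forall k, Z k t <= w k.1 * m t.
  by move=> t i T1t; apply/ZE => o; exact: H.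
apply: (@barrier _ _ Z D (fun k t => w k.1 * m t) (fun k => w k.1 * e)).
- by move=> k s T1s; rewrite mulr_gt0// m0.
- by move=> k s s' T1s ss'; rewrite -mulrA -mulrBr ler_wpM2l ?(ltW (w_gt0 _))// mslope.
- move=> [i [|]] s T1s q q0; rewrite /Z /=;
    have Ts := le_lt_trans TT1 T1s.
  + exact: (transport_left (@Phi_d i) (a_up_inv_gt0 i) (@a_inv_bounds i)
      (@a_inv_decr i) (@B_cont i) (@x_cont i) (@y_cont i) Ts q0).
  + exact: (transport_left (@Phi_d i) (a_up_inv_gt0 i) (@a_inv_bounds i)
      (@a_inv_decr i) (@B_cont i) (@y_cont i) (@x_cont i) Ts q0).
- move=> [i o] s T1s q q0; have Ts := T1P _ T1s.
  have dx := @x_der i s Ts; have dy := @y_der i s Ts.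
  rewrite -(invrK (a i (s, x s 0 i))) in dx.
  rewrite -(invrK (a i (s, y s 0 i))) in dy.
  case: o; rewrite /Z /D /=.
  + exact: (transport_right (@Phi_d i) (a_up_inv_gt0 i) (@a_inv_bounds i)
      (@a_inv_decr i) (@B_cont i) (@x_cont i) (@y_cont i) Ts dx dy q0).
  + exact: (transport_right (@Phi_d i) (a_up_inv_gt0 i) (@a_inv_bounds i)
      (@a_inv_decr i) (@B_cont i) (@y_cont i) (@x_cont i) Ts dy dx q0).
- by move=> [i o]; have /ZE := gapT1 i; exact.
- move=> s T1s Zs [i o] Zis; have Ts := T1P _ T1s.
  have := defect s T1s (fun q j T1q => (ZE j q (w j * m q)).2 (fun o => Zs q (j, o) T1q)) i.
  have -> : w i * ((gain i s + eps) * m s - e) =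
      (gain i s + eps) * (w i * m s) - w i * e by ring.
  have [dF dFE] : exists dF, dF = F i (delayed_input x i s) - F i (delayed_input y i s).
    by eexists.
  rewrite -dFE => dFr.
  have wm0 : 0 < w i * m s by rewrite mulr_gt0// m0.
  have := ler_norm dF; have := ler_norm (- dF); have := ler_norm (r i s).
  have := ler_norm (- r i s); rewrite !normrN => h1 h2 h3 h4.
  have xP u v : Phi i s u - Phi i s v = w i * m s -> v < u /\ w i * m s <= (u - v) / a_low i.
    move=> E; have vu : v < u.
      by apply: (transport_gt0 (@Phi_d i) (a_up_inv_gt0 i) (@a_inv_bounds i) Ts); rewrite E.
    split => //; have /andP[_] := transport_bounds (@Phi_d i)
      (@a_inv_bounds i) Ts (ltW vu).
    by rewrite E [(a_low i)^-1 * _]mulrC.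
  case: o Zis; rewrite /Z /D /= => /xP[vu Mle].
  + have := monotone_drift (dF - r i s) Ts vu Mle (ltW wm0).
    rewrite /X /Y; lra.
  + have := monotone_drift (r i s - dF) Ts vu Mle (ltW wm0).
    rewrite /X /Y; lra.
Qed.

Lemma pinfty_ge_mul (k q : R) : 0 < k -> \forall M \near +oo, q <= k * M.
Proof.
move=> k0; have := @nbhs_pinfty_ge R (q / k) (num_real _).
by apply: filterS => M; rewrite ler_pdivrMr// mulrC.
Qed.

Lemma dist_bounded (K : R) : (forall i t, T <= t -> `|r i t| <= K) ->
  exists M, forall t i, `|x t 0 i - y t 0 i| <= M.
Proof.
move=> rK; have [Mx xM] := x_past T; have [My yM] := y_past T.
have past s j : s <= T -> `|x s 0 j - y s 0 j| <= Mx + My.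
  by move=> sT; rewrite (le_trans (ler_normB _ _))// lerD ?xM ?yM.
(* [M] has to dominate the distance before [T], which enters through the delays, then the gap at
   [T], and finally, through the margin [eps * M], the defect. [K + 1] instead of [K] gives the
   strict inequality required on the barrier. *)
have [M [M0 HM]] : exists M, 0 < M /\ forall i, [/\ Mx + My <= a_up i * w i * M,
    (w i)^-1 * `|gap i T| <= M & K + 1 <= w i * eps * M].
  apply: (@filter_ex _ +oo%R); near=> M; split.
    by near: M; exact: nbhs_pinfty_gt.
  near: M; apply: filter_forall => i; near=> M; split.
  - by near: M; apply: pinfty_ge_mul; rewrite mulr_gt0.
  - by near: M; apply: nbhs_pinfty_ge; exact: num_real.
  - by near: M; apply: pinfty_ge_mul; rewrite mulr_gt0.
have bound t : T <= t -> (forall s i, T <= s <= t -> `|gap i s| <= w i * M) ->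
    forall s j, s <= t -> `|x s 0 j - y s 0 j| <= a_up j * w j * M.
  move=> Tt gM s j st; have [sT|/ltW Ts] := leP s T.
    by have [+ _ _] := HM j; apply: le_trans; exact: past.
  apply: (le_trans (dist_le_gap _ Ts)); rewrite -mulrA ler_wpM2l ?(ltW (a_up_gt0 _))//.
  by rewrite gM// Ts.
have C00 j : 0 <= a_up j * w j * M by rewrite ?mulr_ge0// ltW.
have gapM t i : T <= t -> `|gap i t| <= w i * M.
  apply: (@gap_barrier (fun=> M) 0 T) => //.
  - by move=> *; rewrite mul0r subr0.
  - by move=> j; have [_ + _] := HM j; rewrite mulrC ler_pdivrMr// mulrC.
  - move=> s Ts gM j; rewrite subr0.
    apply: (@lt_le_trans _ _ (w j * gain j s * M + (K + 1))).
      apply: ler_ltD; last by rewrite (le_lt_trans (rK _ _ Ts))// ltrDl.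
      have xyM := bound _ Ts gM; apply: delayed_input_lip.
      + by move=> l p; rewrite xyM// gerBl tau_ge0.
      + by move=> l p; rewrite xyM// gerBl tau'_ge0.
      (* The bound on the past is uniform, so no remote part is split off: the second constant is 0
         and the age is arbitrary. *)
      + move=> l p; have := @stieltjes_lip_dist (eta j l p) (g j l p) (xi j l p) x y l s
          (a_up l * w l * M) 0 0.
        rewrite mulr0 mul0r addr0; apply=> //.
        by move=> q q0; rewrite mul0r addr0 xyM// gerDl.
      + move=> l p; have := @stieltjes_lip_dist (eta' j l p) (g' j l p) (xi' j l p) x y l s
          (a_up l * w l * M) 0 0.
        rewrite mulr0 mul0r addr0; apply=> //.
        by move=> q q0; rewrite mul0r addr0 xyM// gerDl.
    have [_ _ KM] := HM j; rewrite mulrDl mulrDr !mulrA lerD2l.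
    by rewrite -mulrA in KM; rewrite -mulrA.
have [N HN] : exists N, forall i, a_up i * w i * M <= N.
  apply: (@filter_ex _ +oo%R); near=> N; near: N; apply: filter_forall => i.
  by apply: nbhs_pinfty_ge; exact: num_real.
exists (Num.max N (Mx + My)) => t i; rewrite le_max; have [tT|/ltW Tt] := leP t T.
  by rewrite past ?orbT.
apply/orP; left; apply: le_trans (HN i).
by apply: (le_trans (dist_le_gap _ Tt)); rewrite -mulrA ler_wpM2l ?(ltW (a_up_gt0 _))// gapM.
Unshelve. all: by end_near. Qed.

(** [kappa] is independent of [Lam], so the improvement can be iterated. The barrier cannot drop to
    [kappa * Lam] at once: it descends slowly from [Lam] and then stays. Meanwhile the history may
    remain at level [Lam], raised to [(1 + theta) * Lam] by the tails, whereas the damping acts at a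
    height of only [(1 - theta) * Lam]; the margin [eps] has to pay for the difference. *)
Lemma gap_contract (C G : R) :
  (forall t i, `|x t 0 i - y t 0 i| <= C) ->
  (forall i t, T <= t -> gain i t <= G) ->
  (forall i, r i t @[t --> +oo] --> 0) ->
  (forall i j p, t - tau i j p t @[t --> +oo] --> +oo) ->
  (forall i l p, t - tau' i l p t @[t --> +oo] --> +oo) ->
  exists2 kappa, 0 < kappa < 1 & forall Lam, 0 < Lam ->
    (\forall t \near +oo, forall i, `|gap i t| <= w i * Lam) ->
    \forall t \near +oo, forall i, `|gap i t| <= w i * (kappa * Lam).
Proof.
move=> xyC gainG r0 tau_lim tau'_lim.
wlog C_ge0 : C xyC / 0 <= C.
  by apply=> [t i|]; [exact: le_trans (xyC t i) (ler_norm C)|exact: normr_ge0].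
have [Gp [Gp0 gainGp]] : exists G, 0 <= G /\ forall i t, T <= t -> gain i t <= G.
  exists (Num.max 0 G); split; first by rewrite le_max lexx.
  by move=> i t Tt; rewrite le_max gainG ?orbT.
(* theta is chosen so that 2 theta Gp <= eps / 4 and theta <= 1 / 4. *)
pose theta := eps / (8 * Gp + 4 * eps).
have den0 : 0 < 8 * Gp + 4 * eps by rewrite ltr_wpDl ?mulr_ge0 ?mulr_gt0.
have th0 : 0 < theta by rewrite divr_gt0.
have thE : theta * (8 * Gp + 4 * eps) = eps by rewrite divfK// gt_eqF.
have th4 : theta * 4 <= 1.
  rewrite /theta mulrAC ler_pdivrMr// mul1r [eps * 4]mulrC lerDr mulr_ge0//.
clearbody theta.
exists (1 - theta); first by apply/andP; split; lra.
move=> Lam Lam0 [T0 [_ gapT0]].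
(* Neighbourhoods of +oo provide strict inequalities only: the bound on the gap holds for [t > T0],
   and the added 1 turns this into [T1 <= t]. The same shift gives [T3] from [T2]. *)
pose T1 := Num.max T T0 + 1.
have TT1 : T <= T1 by rewrite /T1 ler_wpDr// le_max lexx.
have T01 t : T1 <= t -> T0 < t.
  by apply: lt_le_trans; rewrite /T1 ltr_pwDr// le_max lexx orbT.
have tails (e : bounded_nondecreasing R) (q : R) :
    e 0 - lim (e s @[s --> -oo]) = 1 -> 0 < q ->
    \forall t \near +oo, C * stieltjes_tail e (t - T1) <= q.
  move=> em q0.
  have lim : C * stieltjes_tail e (t - T1) @[t --> +oo] --> C * 0.
    apply: cvgM; first exact: cvg_cst.
    apply: (@cvg_comp _ _ _ (fun t => t - T1) (stieltjes_tail e) _ +oo%R).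
      apply/cvgryPge => A; near=> t; rewrite lerBrDr.
      by near: t; apply: nbhs_pinfty_ge; exact: num_real.
    exact: stieltjes_tail_cvg.
  by apply: (cvgr_le _ lim); rewrite mulr0.
have [T2 [_ HT2]] : \forall t \near +oo, [/\ T1 <= t,
    forall i, `|r i t| <= w i * (eps / 4 * Lam),
    forall i j p, T1 <= t - tau i j p t,
    forall i l p, T1 <= t - tau' i l p t &
    (forall i j p, C * stieltjes_tail (eta i j p) (t - T1) <= a_up j * w j * (theta * Lam)) /\
    (forall i l p, C * stieltjes_tail (eta' i l p) (t - T1) <= a_up l * w l * (theta * Lam))].
  near=> t; split.
  - by near: t; apply: nbhs_pinfty_ge; exact: num_real.
  - near: t; apply: filter_forall => i.
    have := r0 i => /cvgr0_norm_le; apply.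
    by rewrite !mulr_gt0.
  - near: t; apply: filter_forall => i; apply: filter_forall => j.
    apply: filter_forall => p.
    by have /cvgryPge Hp := tau_lim i j p; exact: Hp.
  - near: t; apply: filter_forall => i; apply: filter_forall => j.
    apply: filter_forall => p.
    by have /cvgryPge Hp := tau'_lim i j p; exact: Hp.
  - split; near: t; do 3 apply: filter_forall => ?.
    + by apply: tails => //; apply: mulr_gt0; exact: mulr_gt0.
    + by apply: tails => //; apply: mulr_gt0; exact: mulr_gt0.
pose T3 := T2 + 1.
have {HT2}HT3 t (T3t : T3 <= t) := HT2 t (lt_le_trans (ltr_pwDr ltr01 (lexx T2)) T3t).
have [T13 _ _ _ _] := HT3 _ (lexx T3).
have TT3 := le_trans TT1 T13.
(* Budget of the margin, in units of [eps * Lam]: a quarter for the defect, at most a quarter for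
   the excess [2 * theta * gain], at most a quarter for the lost height [theta * eps], and an eighth
   for the descent of the barrier, which is 7/8 in all. *)
pose e := eps * Lam / 8.
have e0 : 0 < e by rewrite divr_gt0 ?mulr_gt0.
pose m t := Num.max ((1 - theta) * Lam) (Lam - e * (t - T3)).
have kap0 : 0 < (1 - theta) * Lam by rewrite mulr_gt0//; lra.
have close s j : T1 <= s -> `|x s 0 j - y s 0 j| <= a_up j * w j * Lam.
  move=> T1s; apply: (le_trans (dist_le_gap _ (le_trans TT1 T1s))).
  by rewrite -mulrA ler_wpM2l ?(ltW (a_up_gt0 _))// gapT0// T01.
have input_close t i : T3 <= t ->
    `|F i (delayed_input x i t) - F i (delayed_input y i t)| <=
    w i * gain i t * ((1 + theta) * Lam).
  move=> T3t; have [T1t _ tauT tauT' [tl tl']] := HT3 _ T3t.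
  have aw0 j : 0 <= a_up j * w j by rewrite mulr_ge0// ltW.
  have up j : a_up j * w j * Lam <= a_up j * w j * ((1 + theta) * Lam).
    by rewrite ler_wpM2l// ler_peMl ?(ltW Lam0)// lerDl ltW.
  (* Back to the instant [T1] the level [Lam] applies; on the older part of the history only the
     global bound [C] is known. *)
  have hist j s : s <= 0 -> `|x (t + s) 0 j - y (t + s) 0 j| <=
      a_up j * w j * Lam + C * (s <= - (t - T1))%R%:R.
    move=> s0; have [sT|sT] := leP s (- (t - T1)).
      by rewrite mulr1 ler_wpDl// mulr_ge0// ltW.
    by rewrite mulr0 addr0 close//; lra.
  apply: delayed_input_lip.
  - by move=> j p; apply: le_trans (up j); exact: close.
  - by move=> j p; apply: le_trans (up j); exact: close.
  - move=> j p; apply: (le_trans (stieltjes_lip_dist (eta_mass i j p) (@g_cont i j p)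
      (xi_gt0 i j p) (g_lip i j p) (@x_cont j) (@y_cont j) x_past y_past _ C_ge0 (hist j))).
      by rewrite mulr_ge0// ltW.
    rewrite -[xi i j p * C * _]mulrA -mulrDr ler_wpM2l ?(ltW (xi_gt0 _ _ _))//.
    by rewrite mulrDl mul1r mulrDr lerD2l.
  - move=> j p; apply: (le_trans (stieltjes_lip_dist (eta'_mass i j p) (@g'_cont i j p)
      (xi'_gt0 i j p) (g'_lip i j p) (@x_cont j) (@y_cont j) x_past y_past _ C_ge0 (hist j))).
      by rewrite mulr_ge0// ltW.
    rewrite -[xi' i j p * C * _]mulrA -mulrDr ler_wpM2l ?(ltW (xi'_gt0 _ _ _))//.
    by rewrite mulrDl mul1r mulrDr lerD2l.
have gapm t i : T3 <= t -> `|gap i t| <= w i * m t.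
  apply: (@gap_barrier m e T3) => //.
  - by move=> s _; rewrite lt_max kap0.
  - move=> s s' T3s ss'; rewrite lerBlDr /m ge_max; apply/andP; split.
      apply: ler_wpDr; last by rewrite le_max lexx.
      by apply: mulr_ge0; [exact: ltW|rewrite subr_ge0].
    rewrite -lerBlDr le_max; apply/orP; right; lra.
  - move=> j; rewrite /m subrr mulr0 subr0; apply: (@le_trans _ _ (w j * Lam)).
      by apply: gapT0; exact: T01.
    by rewrite ler_wpM2l ?(ltW (w_gt0 _))// le_max lexx orbT.
  - move=> s T3s _ j; have [_ rs _ _ _] := HT3 _ T3s.
    have Ts := le_trans TT3 T3s.
    apply: (@le_lt_trans _ _ (w j * (gain j s * ((1 + theta) * Lam) + eps / 4 * Lam))).
      by rewrite mulrDr mulrA lerD// input_close.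
    rewrite ltr_pM2l//.
    apply: (@lt_le_trans _ _ ((gain j s + eps) * ((1 - theta) * Lam) - e)); last first.
      rewrite lerB// ler_wpM2l ?addr_ge0 ?gain_ge0 ?(ltW eps_gt0)//.
      by rewrite /m le_max lexx.
    rewrite /e.
    have -> : gain j s * ((1 + theta) * Lam) + eps / 4 * Lam =
      (gain j s * (1 + theta) + eps / 4) * Lam by ring.
    have -> : (gain j s + eps) * ((1 - theta) * Lam) - eps * Lam / 8 =
      ((gain j s + eps) * (1 - theta) - eps / 8) * Lam by ring.
    rewrite ltr_pM2r//.
    have : theta * gain j s <= theta * Gp by rewrite ler_wpM2l ?gainGp// ltW.
    have : theta * eps * 4 <= eps by rewrite mulrAC ler_piMl// ltW.
    by have := mulr_gt0 th0 eps_gt0; lra.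
near=> t => i.
have T3t : T3 <= t by near: t; apply: nbhs_pinfty_ge; exact: num_real.
apply: (le_trans (gapm t i T3t)); rewrite ler_wpM2l ?(ltW (w_gt0 _))//.
rewrite /m ge_max lexx/= (le_trans _ (ltW kap0))// subr_le0 -ler_pdivrMl// lerBrDr.
by near: t; apply: nbhs_pinfty_ge; exact: num_real.
Unshelve. all: by end_near. Qed.

(** The global bound [C] provides a first level [Lam]; each level [kappa ^+ k * Lam] is then valid
    from some time on, depending on [k]. *)
Lemma dist_cvg0 (C G : R) :
  (forall t i, `|x t 0 i - y t 0 i| <= C) ->
  (forall i t, T <= t -> gain i t <= G) ->
  (forall i, r i t @[t --> +oo] --> 0) ->
  (forall i j p, t - tau i j p t @[t --> +oo] --> +oo) ->
  (forall i l p, t - tau' i l p t @[t --> +oo] --> +oo) ->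
  forall i, x t 0 i - y t 0 i @[t --> +oo] --> 0.
Proof.
move=> xyC gainG r0 tau_lim tau'_lim i.
have [kappa /andP[kap0 kap1] contr] := gap_contract xyC gainG r0 tau_lim tau'_lim.
have C0 : 0 <= C by rewrite (le_trans (normr_ge0 _) (xyC 0 i)).
have [Lam [Lam0 HLam]] : exists Lam, 0 < Lam /\ forall j, (a_low j)^-1 * C <= w j * Lam.
  apply: (@filter_ex _ +oo%R); near=> Lam; split.
    by near: Lam; apply: nbhs_pinfty_gt; exact: num_real.
  by near: Lam; apply: filter_forall => j; exact: pinfty_ge_mul.
have iter k : \forall t \near +oo, forall j, `|gap j t| <= w j * (kappa ^+ k * Lam).
  elim: k => [|k IH]; last first.
    have kL : 0 < kappa ^+ k * Lam by rewrite mulr_gt0// exprn_gt0.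
    by apply: filterS (contr _ kL IH) => t H j; rewrite exprS -mulrA; exact: H.
  near=> t => j; rewrite mul1r (le_trans _ (HLam j))//.
  apply: (le_trans (gap_le_dist _ _)).
    by near: t; apply: nbhs_pinfty_ge; exact: num_real.
  by rewrite ler_wpM2l// invr_ge0 ltW.
apply/cvgr0Pnorm_le => e e0.
have [k Hk] : exists k, a_up i * (w i * (kappa ^+ k * Lam)) <= e.
  have lim : a_up i * (w i * (kappa ^+ k * Lam)) @[k --> \oo] --> a_up i * (w i * (0 * Lam)).
    apply: cvgM; first exact: cvg_cst.
    apply: cvgM; first exact: cvg_cst.
    apply: cvgM; last exact: cvg_cst.
    by apply: cvg_expr; rewrite ger0_norm// ltW.
  rewrite mul0r !mulr0 in lim.
  by apply: (@filter_ex _ \oo); apply: (cvgr_le _ lim).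
near=> t; apply: le_trans Hk; apply: (le_trans (dist_le_gap _ _)).
  by near: t; apply: nbhs_pinfty_ge; exact: num_real.
rewrite ler_wpM2l ?(ltW (a_up_gt0 _))//; move: i; near: t; exact: iter.
Unshelve. all: by end_near. Qed.

End comparison.

(** * Derivatives, restrictions to the half-line and limits at +oo *)

Lemma derivative_within_is_derive (R : realType) (D : set R) (f : R -> R) (t l : R) :
  nbhs t D -> derivative_within D f t l -> is_derive t 1 f l.
Proof.
move=> Dt fl.
have H : h^-1 *: (f (h *: 1 + t) - f t) @[h --> 0^'] --> l.
  apply/cvgrPdist_lt => e e0.
  move/cvgrPdist_lt : fl => /(_ e e0) [r1 /= r10 r1P].
  have [r2 /= r20 r2P] := Dt.
  exists (Num.min r1 r2); first by rewrite /= lt_min r10.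
  move=> h /=; rewrite sub0r normrN lt_min => /andP[hr1 hr2] h0.
  have := r1P (h + t); rewrite /= opprD addrCA subrr addr0 normrN => /(_ hr1).
  rewrite -subr_eq0 addrK => /(_ h0).
  rewrite [h *: 1]mulr1 [_ *: _]mulrC; apply.
  by apply: r2P; rewrite /= opprD addrCA subrr addr0 normrN.
apply: DeriveDef; first by apply/cvg_ex; exists l.
exact/cvg_lim.
Qed.

Lemma is_derive_right_slope (R : realType) (f : R -> R) (t l : R) :
  is_derive t 1 f l -> (f s - f t) / (s - t) @[s --> t^'+] --> l.
Proof.
move=> df; rewrite -[l]mulr1.
apply: (@caratheodory_right_chain R f id t l 1 df); first exact: cvg_id.
have c1 : (cst 1 : R -> R) @ t^'+ --> (1 : R) by exact: cvg_cst.
apply: cvg_trans c1; apply: near_eq_cvg; near=> s => /=.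
by rewrite divff// subr_eq0 gt_eqF//; near: s; exact: nbhs_right_gt.
Unshelve. all: by end_near. Qed.

Lemma within_itv0_continuous_at (R : realType) (f : R -> R) (t : R) :
  {within `[0, +oo[, continuous f} -> 0 < t -> {for t, continuous f}.
Proof.
by move=> /continuous_within_itvcyP[cf _] t0; apply: cf; rewrite in_itv/= t0.
Qed.

Lemma within_half_plane_section (R : realType) (f : R * R -> R) (t : R) :
  {within [set z | 0 <= z.1], continuous f} -> 0 <= t ->
  continuous (fun u => f (t, u)).
Proof.
move=> /subspace_continuousP cf t0 u.
apply: (@cvg_comp _ _ _ (fun v => (t, v)) f _ _ _ _ (cf (t, u) t0)).
move=> A /= WA.
have : (fun v : R => (t, v)) v @[v --> u] --> (t, u).
  apply: (@cvg_pair R R R (nbhs u) (nbhs t) (nbhs u) _ _ _ (cst t) id).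
    exact: cvg_cst.
  exact: cvg_id.
move=> tu; have WA' : \forall v \near u, 0 <= t -> A (t, v) by exact: (tu _ WA).
change (\forall v \near u, A (t, v)).
by apply: filterS WA' => v; exact.
Qed.

(** The upper limit is an infimum of suprema over neighbourhoods of +oo, so one of these suprema is
    already negative and yields a margin uniform in [t]. For the value -oo the margin is free, and 1
    is taken. *)
Lemma limf_esup_lt0_near (R : realType) (f : R -> R) :
  (limf_esup (fun t => (f t)%:E) (+oo%R : set_system R) < 0)%E ->
  exists2 eps, 0 < eps & \forall t \near +oo, f t <= - eps.
Proof.
rewrite /limf_esup => /ereal_inf_lt[_ [V Vy <-]] supV.
have [eps eps0 supe] : exists2 eps, 0 < eps & (ereal_sup [set (f t)%:E | t in V] <= (- eps)%:E)%E.
  move: supV; case: ereal_sup => [q| |]//; last by exists 1; rewrite ?leNye.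
  by rewrite lte_fin => q0; exists (- q); rewrite ?oppr_gt0// opprK.
exists eps => //; move: Vy; apply: filterS => t Vt.
rewrite -lee_fin; apply: le_trans supe; apply: ereal_sup_ubound.
by exists t.
Qed.

Lemma cvg_sumr (R : realType) (K : finType) (T : Type) (G : set_system T)
    (FG : Filter G) (f : K -> T -> R) (l : K -> R) :
  (forall k, f k x @[x --> G] --> l k) ->
  \sum_k f k x @[x --> G] --> \sum_k l k.
Proof. by move=> fl; apply: cvg_big => //; exact: add_continuous. Qed.

Lemma cvg0_bounded_mulr (R : realType) (T : Type) (G : set_system T)
    (FG : Filter G) (f k : T -> R) (M : R) :
  f x @[x --> G] --> 0 -> (\forall x \near G, `|k x| <= M) ->
  f x * k x @[x --> G] --> 0.
Proof.
move=> f0 kM; apply/cvgr0Pnorm_le => e e0.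
have M1 : 0 < `|M| + 1 by rewrite ltr_wpDl.
have fe := (cvgr0Pnorm_le _).1 f0 _ (divr_gt0 e0 M1).
near=> x.
have kx : `|k x| <= M by near: x; exact: kM.
have fx : `|f x| <= e / (`|M| + 1) by near: x; exact: fe.
rewrite ler_pdivlMr// in fx.
rewrite normrM; apply: le_trans fx; rewrite ler_wpM2l//.
by rewrite (le_trans kx)// (le_trans (ler_norm _))// lerDl.
Unshelve. all: by end_near. Qed.

Lemma cvg0_le_norm (R : realType) (T : Type) (G : set_system T)
    (FG : Filter G) (f k : T -> R) :
  k x @[x --> G] --> 0 -> (\forall x \near G, `|f x| <= k x) ->
  f x @[x --> G] --> 0.
Proof.
move=> k0 fk; apply/cvgr0Pnorm_le => e e0.
have ke := (cvgr0Pnorm_le _).1 k0 _ e0.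
near=> x.
have fx : `|f x| <= k x by near: x; exact: fk.
have kx : `|k x| <= e by near: x; exact: ke.
by rewrite (le_trans fx)// (le_trans (ler_norm _)).
Unshelve. all: by end_near. Qed.

Lemma coord_le_norm (R : realType) n (v : 'rV[R]_n) j : `|v 0 j| <= `|v|.
Proof.
rewrite [leRHS]/Num.norm /= mx_normrE.
by apply/bigmax_geP; right => /=; exists (0, j).
Qed.

Lemma norm_le_coord (R : realType) n (v : 'rV[R]_n) e :
  0 <= e -> (forall j, `|v 0 j| <= e) -> `|v| <= e.
Proof.
move=> e0 ve; rewrite [leLHS]/Num.norm /= mx_normrE.
by apply: bigmax_le => // -[i j] _; rewrite ord1.
Qed.

(** * Regularity and boundedness of solutions on the past *)

Section solution_facts.
Context {R : realType} {n : nat}.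
Variables (G : (R -> 'rV[R]_n) -> 'I_n -> R -> R) (x : R -> 'rV[R]_n).
Hypothesis x_sol : solution G +oo%E x.

Lemma solution_continuous : continuous x.
Proof.
have E : [set t : R | (t%:E < +oo)%E] = setT.
  by apply/seteqP; split => // t _ /=; rewrite ltry.
have [cx _] := x_sol; rewrite E in cx.
exact/continuous_subspace_setT.
Qed.

Lemma solution_coord_continuous j : continuous (fun s => x s 0 j).
Proof.
move=> s; apply: (@continuous_comp _ _ _ x (fun v : 'rV[R]_n => v 0 j)).
  exact: solution_continuous.
exact: coord_continuous.
Qed.

Lemma solution_past_bounded : past_bounded x.
Proof.
move=> t; have [_ [t0 [phi [_ _ [_ [M [_ phiM]]] xphi _]]]] := x_sol.
have cn : continuous (fun s => `|x s|).
  by move=> s; apply: cvg_norm; exact: solution_continuous.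
have t0t : t0 <= Num.max t t0 by rewrite le_max lexx orbT.
have [s1 _ xs1] := EVT_max t0t (continuous_subspaceT cn).
exists (Num.max (M + 1) `|x s1|) => s j st; rewrite le_max.
have [st0|/ltW t0s] := leP s t0; last first.
  have := xs1 s; rewrite in_itv/= t0s le_max st => /(_ isT) xs.
  by rewrite (le_trans (coord_le_norm _ _) xs) orbT.
apply/orP; left; rewrite (le_trans (coord_le_norm _ _))//.
rewrite -[s](subrKC t0) xphi ?subr_le0//; apply: phiM; first by rewrite ltrDl.
by rewrite /= in_itv/= subr_le0.
Qed.

Lemma solution_is_derive : exists T, forall t : R, T <= t ->
  forall i, is_derive t 1 (fun s => x s 0 i) (G x i t).
Proof.
have [_ [t0 [phi [t00 _ _ _ xG]]]] := x_sol.
(* At [t0] only the derivative from the right is given; strictly beyond it the derivative within the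
   interval is the usual one. *)
exists (t0 + 1) => t t0t i; have [_ dx] := xG i.
have t0t' : t0 < t by rewrite (lt_le_trans _ t0t)// ltrDl.
apply: derivative_within_is_derive (dx t _); last by split; rewrite ?ltry// ltW.
near=> s; split; last by rewrite ltry.
by apply: ltW; near: s; exact: lt_nbhsr.
Unshelve. all: by end_near. Qed.

End solution_facts.

(** The derivative of 1 / f is - f' / f^2 <= - mu. The mean value theorem is used instead of an
    integral, since [df] need be neither continuous nor integrable. *)
Lemma inv_decrement (R : realType) (f df B : R -> R) (s t mu : R) : s <= t ->
  (forall q, s <= q <= t -> 0 < f q) ->
  (forall q : R, s <= q <= t -> is_derive q 1 f (df q)) ->
  (forall q, s <= q <= t -> mu * f q ^+ 2 <= df q) ->
  (f t)^-1 - (f s)^-1 <= - mu * (t - s).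
Proof.
move=> st f0 fd dfmu.
have itv (q : R) : q \in `]s, t[ -> s <= q <= t by rewrite in_itv/= => /andP[/ltW -> /ltW ->].
have cf : {within `[s, t], continuous (fun q => (f q)^-1)}.
  apply: continuous_in_subspaceT => q; rewrite inE/= in_itv/= => stq.
  apply: cvgV; first by rewrite gt_eqF// f0.
  have [dfq _] := fd q stq.
  exact/differentiable_continuous/derivable1_diffP.
have dinv (q : R) : q \in `]s, t[ -> is_derive q 1 (fun q => (f q)^-1) (- df q / f q ^+ 2).
  move=> /itv stq.
  have fq0 : f q != 0 by rewrite gt_eqF// f0.
  have [dfq dfE] := fd q stq.
  apply: DeriveDef; first exact: derivableV.
  by rewrite deriveV// dfE [_ *: _]mulNr mulNr mulrC.
have [q + ->] := MVT_segment st dinv cf; rewrite in_itv/= => stq.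
rewrite ler_wpM2r ?subr_ge0// mulNr lerN2 ler_pdivlMr ?dfmu// exprn_gt0//.
exact: f0.
Qed.

Lemma lipschitz_of_derive (R : realType) (f df : R -> R) (T L : R) :
  (forall t : R, T <= t -> is_derive t 1 f (df t)) ->
  (forall t, T <= t -> `|df t| <= L) ->
  forall s t, T <= s -> T <= t -> `|f t - f s| <= L * `|t - s|.
Proof.
move=> fd dfL s t Ts Tt; wlog st : s t Ts Tt / s <= t.
  by move=> H; have [/H|/ltW/H] := leP s t; [|rewrite distrC (distrC t)]; apply.
have cf : {within `[s, t], continuous f}.
  apply: continuous_in_subspaceT => q; rewrite inE/= in_itv/= => /andP[sq _].
  have [dfq _] := fd q (le_trans Ts sq).
  exact/differentiable_continuous/derivable1_diffP.
have [|q /[!in_itv]/= /andP[sq _] ->] := @MVT_segment R f df s t st _ cf.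
  by move=> q /[!in_itv]/= /andP[/ltW sq _]; apply: fd; exact: le_trans sq.
by rewrite normrM ler_wpM2r// dfL// (le_trans Ts).
Qed.

Lemma finite_bound (R : realType) (K : finType) (k : K -> R) :
  exists2 M, 0 <= M & forall i, k i <= M.
Proof.
exists (\big[Num.max/0]_i k i) => [|i]; last exact: le_bigmax.
by apply: bigmax_ge_id.
Qed.

Lemma uniform_bound (R : realType) (K : finType) (D : set R) (f : K -> R -> R) :
  (forall k, [bounded f k t | t in D]) ->
  exists2 M, 0 <= M & forall k t, D t -> `|f k t| <= M.
Proof.
move=> fb.
have /choice[m fm] : forall k, exists m, forall t, D t -> `|f k t| <= m.
  move=> k; have [m [_ fm]] := fb k.
  by exists (m + 1); apply: fm; rewrite ltrDl.
have [M M0 mM] := finite_bound m.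
by exists M => // k t Dt; rewrite (le_trans (fm _ _ Dt)).
Qed.

(** * Nonlinear terms along a bounded function *)

Section inputs.
Context {R : realType} {n P : nat}.
Variables (F : 'I_n -> R * R -> R)
  (h f : 'I_n -> 'I_n -> 'I_n -> 'I_P -> R * R -> R)
  (g g' : 'I_n -> 'I_n -> 'I_P -> R -> R)
  (eta eta' : 'I_n -> 'I_n -> 'I_P -> bounded_nondecreasing R).
Variables (gamma1 gamma2 mu1 mu2 : 'I_n -> 'I_n -> 'I_n -> 'I_P -> R)
  (xi xi' : 'I_n -> 'I_n -> 'I_P -> R) (zeta sigma : 'I_n -> R).
Hypothesis gamma1_gt0 : forall i j l p, 0 < gamma1 i j l p.
Hypothesis gamma2_gt0 : forall i j l p, 0 < gamma2 i j l p.
Hypothesis mu1_gt0 : forall i j l p, 0 < mu1 i j l p.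
Hypothesis mu2_gt0 : forall i j l p, 0 < mu2 i j l p.
Hypothesis h_lip : forall i j l p u1 u2 v1 v2,
  `|h i j l p (u1, u2) - h i j l p (v1, v2)|
    <= gamma1 i j l p * `|u1 - v1| + gamma2 i j l p * `|u2 - v2|.
Hypothesis f_lip : forall i j l p u1 u2 v1 v2,
  `|f i j l p (u1, u2) - f i j l p (v1, v2)|
    <= mu1 i j l p * `|u1 - v1| + mu2 i j l p * `|u2 - v2|.
Hypothesis xi_gt0 : forall i j p, 0 < xi i j p.
Hypothesis xi'_gt0 : forall i j p, 0 < xi' i j p.
Hypothesis zeta_gt0 : forall i, 0 < zeta i.
Hypothesis sigma_gt0 : forall i, 0 < sigma i.
Hypothesis g_lip : forall i j p u v, `|g i j p u - g i j p v| <= xi i j p * `|u - v|.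
Hypothesis g'_lip : forall i j p u v, `|g' i j p u - g' i j p v| <= xi' i j p * `|u - v|.
Hypothesis F_lip : forall i u1 u2 v1 v2,
  `|F i (u1, u2) - F i (v1, v2)| <= zeta i * `|u1 - v1| + sigma i * `|u2 - v2|.
Hypothesis eta_mass : forall i j p,
  eta i j p 0 - lim (eta i j p s @[s --> -oo]) = 1.
Hypothesis eta'_mass : forall i l p,
  eta' i l p 0 - lim (eta' i l p s @[s --> -oo]) = 1.
Hypothesis g_cont : forall i j p, continuous (g i j p).
Hypothesis g'_cont : forall i l p, continuous (g' i l p).
Variables (x : R -> 'rV[R]_n) (M : R).
Hypothesis x_cont : forall j, continuous (fun s => x s 0 j).
Hypothesis M_ge0 : 0 <= M.
Hypothesis x_bounded : forall t j, `|x t 0 j| <= M.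

Let x_past : past_bounded x. Proof. by move=> t; exists M => s j _. Qed.
Let x0_past : past_bounded (fun=> 0 : 'rV[R]_n).
Proof. by move=> t; exists 0 => s j _; rewrite mxE normr0. Qed.

Let lip_bound (k : R * R -> R) (m1 m2 : R) u1 u2 v1 v2 : 0 < m1 -> 0 < m2 ->
  (forall u1 u2 v1 v2, `|k (u1, u2) - k (v1, v2)| <= m1 * `|u1 - v1| + m2 * `|u2 - v2|) ->
  `|u1| <= v1 -> `|u2| <= v2 -> `|k (u1, u2)| <= `|k (0, 0)| + (m1 * v1 + m2 * v2).
Proof.
move=> m10 m20 kl u1v u2v; rewrite -lerBlDl; apply: (le_trans (lerB_dist _ _)).
apply: (le_trans (kl _ _ _ _)); rewrite !subr0.
by rewrite lerD// ler_wpM2l// ltW.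
Qed.

(** Comparison with the zero function, whose contribution, the integral of the constant [k 0], is
    independent of [t]. *)
Lemma stieltjes_bounded (e : bounded_nondecreasing R) (k : R -> R) (L : R) j t :
  e 0 - lim (e s @[s --> -oo]) = 1 -> continuous k -> 0 < L ->
  (forall u v, `|k u - k v| <= L * `|u - v|) ->
  `|stieltjes_integral e (fun s => k (x (t + s) 0 j))| <=
    L * M + `|stieltjes_integral e (fun=> k 0)|.
Proof.
move=> em kc L0 kl; rewrite -lerBlDr; apply: (le_trans (lerB_dist _ _)).
have -> : (fun=> k 0) = (fun s => k ((fun=> 0 : 'rV[R]_n) (t + s) 0 j)).
  by apply/funext => s; rewrite mxE.
have := @stieltjes_lip_dist R n e k L x (fun=> 0) j t M 0 0 em kc L0 kl (@x_cont j) _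
  x_past x0_past M_ge0 (lexx 0).
rewrite mulr0 mul0r addr0; apply; first by move=> s; exact: cvg_cst.
by move=> s _; rewrite mxE subr0 mul0r addr0.
Qed.

Variables (c d : 'I_n -> 'I_n -> 'I_n -> 'I_P -> R -> R)
  (tau tau' : 'I_n -> 'I_n -> 'I_P -> R -> R) (T C : R).
Hypothesis c_le : forall i j l p t, T <= t -> `|c i j l p t| <= C.
Hypothesis d_le : forall i j l p t, T <= t -> `|d i j l p t| <= C.

Let hB i j l p := `|h i j l p (0, 0)| + (gamma1 i j l p * M + gamma2 i j l p * M).
Let fB i j l p := `|f i j l p (0, 0)| +
  (mu1 i j l p * (xi i j p * M + `|stieltjes_integral (eta i j p) (fun=> g i j p 0)|) +
   mu2 i j l p * (xi' i l p * M + `|stieltjes_integral (eta' i l p) (fun=> g' i l p 0)|)).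

Let h_bounded i j l p s t : `|h i j l p (x s 0 j, x t 0 l)| <= hB i j l p.
Proof. by apply: lip_bound. Qed.

Let f_bounded i j l p t : `|f i j l p
    (stieltjes_integral (eta i j p) (fun s => g i j p (x (t + s) 0 j)),
     stieltjes_integral (eta' i l p) (fun s => g' i l p (x (t + s) 0 l)))| <= fB i j l p.
Proof. by apply: lip_bound => //; exact: stieltjes_bounded. Qed.

Let sum3_bounded (q H K : 'I_n -> 'I_n -> 'I_P -> R) :
  (forall j l p, `|q j l p| <= C) -> (forall j l p, `|H j l p| <= K j l p) ->
  `|\sum_(p < P) \sum_(j < n) \sum_(l < n) q j l p * H j l p| <=
  \sum_(p < P) \sum_(j < n) \sum_(l < n) C * K j l p.
Proof.
move=> qC HK.
do 3 (rewrite (le_trans (ler_norm_sum _ _ _))// ler_sum// => ? _).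
by rewrite normrM ler_pM.
Qed.

Lemma delayed_input_bounded : exists2 K, 0 <= K & forall i t, T <= t ->
  `|F i (delayed_input c d h f tau tau' g g' eta eta' x i t)| <= K.
Proof.
have [K K0 HK] := finite_bound (fun i => `|F i (0, 0)| +
  (zeta i * \sum_(p < P) \sum_(j < n) \sum_(l < n) C * hB i j l p +
   sigma i * \sum_(p < P) \sum_(j < n) \sum_(l < n) C * fB i j l p)).
exists K => // i t Tt; apply: le_trans (HK i); apply: lip_bound => //.
  by apply: (@sum3_bounded (fun j l p => c i j l p t)) => j l p; [exact: c_le|exact: h_bounded].
by apply: (@sum3_bounded (fun j l p => d i j l p t)) => j l p; [exact: d_le|exact: f_bounded].
Qed.

Variables (cH dH : 'I_n -> 'I_n -> 'I_n -> 'I_P -> R -> R)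
  (tauH tau'H : 'I_n -> 'I_n -> 'I_P -> R -> R) (L : R).
Hypothesis x_lip : forall j s t, T <= s -> T <= t ->
  `|x t 0 j - x s 0 j| <= L * `|t - s|.
Hypothesis cH_cvg : forall i j l p, c i j l p t - cH i j l p t @[t --> +oo] --> 0.
Hypothesis dH_cvg : forall i j l p, d i j l p t - dH i j l p t @[t --> +oo] --> 0.
Hypothesis tauH_cvg : forall i j p, tau i j p t - tauH i j p t @[t --> +oo] --> 0.
Hypothesis tau'H_cvg : forall i j p, tau' i j p t - tau'H i j p t @[t --> +oo] --> 0.
Hypothesis tau_lim : forall i j p, t - tau i j p t @[t --> +oo] --> +oo.
Hypothesis tau'_lim : forall i l p, t - tau' i l p t @[t --> +oo] --> +oo.

Let delayed_cvg j (u v : R -> R) : u t - v t @[t --> +oo] --> 0 ->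
  t - u t @[t --> +oo] --> +oo ->
  x (t - v t) 0 j - x (t - u t) 0 j @[t --> +oo] --> 0.
Proof.
move=> uv tu.
have lim : L * `|u t - v t| @[t --> +oo] --> 0.
  rewrite -(mulr0 L); apply: cvgM; first exact: cvg_cst.
  by rewrite -(normr0 R); apply: cvg_norm.
apply: (cvg0_le_norm _ lim).
(* Both delayed instants must lie beyond [T], where [x] is Lipschitz: one unit is reserved for
   [u t - v t]. *)
have near1 := (cvgryPge _).1 tu (T + 1).
have near2 := (cvgr0Pnorm_le _).1 uv _ ltr01.
near=> t.
have t1 : T + 1 <= t - u t by near: t; exact: near1.
have t2 : `|u t - v t| <= 1 by near: t; exact: near2.
have -> : u t - v t = (t - v t) - (t - u t) by ring.
apply: x_lip; first by lra.
by move: t2; rewrite ler_norml => /andP[? _]; lra.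
Unshelve. all: by end_near. Qed.

Let sum3_cvg0 (q H : 'I_n -> 'I_n -> 'I_P -> R -> R) (q' H' : 'I_n -> 'I_n -> 'I_P -> R -> R) :
  (forall j l p, q j l p t * H j l p t - q' j l p t * H' j l p t @[t --> +oo] --> 0) ->
  \sum_(p < P) \sum_(j < n) \sum_(l < n) q j l p t * H j l p t -
  \sum_(p < P) \sum_(j < n) \sum_(l < n) q' j l p t * H' j l p t @[t --> +oo] --> 0.
Proof.
move=> qH.
have -> : (fun t => \sum_(p < P) \sum_(j < n) \sum_(l < n) q j l p t * H j l p t -
    \sum_(p < P) \sum_(j < n) \sum_(l < n) q' j l p t * H' j l p t) =
  (fun t => \sum_(p < P) \sum_(j < n) \sum_(l < n)
    (q j l p t * H j l p t - q' j l p t * H' j l p t)).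
  apply/funext => t; rewrite -sumrB; apply: eq_bigr => p _.
  by rewrite -sumrB; apply: eq_bigr => j _; rewrite -sumrB.
have sum0 (K : finType) (k : K -> R -> R) :
    (forall i, k i t @[t --> +oo] --> 0) -> \sum_i k i t @[t --> +oo] --> 0.
  by move=> /(@cvg_sumr _ _ _ _ _ k (fun=> 0)); rewrite big1.
by apply: (@sum0) => p; apply: (@sum0) => j; exact: (@sum0).
Qed.

Lemma delayed_input_cvg0 i :
  F i (delayed_input cH dH h f tauH tau'H g g' eta eta' x i t) -
  F i (delayed_input c d h f tau tau' g g' eta eta' x i t) @[t --> +oo] --> 0.
Proof.
have C_near (q : R -> R) : (forall t, T <= t -> `|q t| <= C) -> \forall t \near +oo, `|q t| <= C.
  by move=> qC; apply: filterS (@nbhs_pinfty_ge R T (num_real _)) => t; exact: qC.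
have diffN (q qH : R -> R) : q t - qH t @[t --> +oo] --> 0 -> qH t - q t @[t --> +oo] --> 0.
  move=> /cvgN; rewrite oppr0; apply: cvg_trans; apply: near_eq_cvg.
  by near=> t; rewrite /= opprB.
have lim (u v : R -> R) : u t @[t --> +oo] --> 0 -> v t @[t --> +oo] --> 0 ->
    zeta i * `|u t| + sigma i * `|v t| @[t --> +oo] --> 0.
  move=> u0 v0; rewrite -[X in _ --> X](_ : zeta i * `|0 : R| + sigma i * `|0 : R| = 0); last first.
    by rewrite normr0 !mulr0 addr0.
  by apply: cvgD; apply: cvgM; [exact: cvg_cst|exact: cvg_norm|exact: cvg_cst|exact: cvg_norm].
apply: cvg0_le_norm; last by near=> t; exact: F_lip.
apply: lim; apply: sum3_cvg0 => j l p.
(* The difference of products is split so that the change of coefficient multiplies the bounded [h],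
   and the change of delays is multiplied by the bounded coefficient [c]. *)
- have -> : (fun t => cH i j l p t *
        h i j l p (x (t - tauH i j p t) 0 j, x (t - tau'H i l p t) 0 l) -
      c i j l p t * h i j l p (x (t - tau i j p t) 0 j, x (t - tau' i l p t) 0 l)) =
    (fun t => (cH i j l p t - c i j l p t) *
        h i j l p (x (t - tauH i j p t) 0 j, x (t - tau'H i l p t) 0 l) +
      (h i j l p (x (t - tauH i j p t) 0 j, x (t - tau'H i l p t) 0 l) -
       h i j l p (x (t - tau i j p t) 0 j, x (t - tau' i l p t) 0 l)) * c i j l p t).
    by apply/funext => t; ring.
  rewrite -[X in _ --> X]addr0; apply: cvgD.
    apply: (@cvg0_bounded_mulr _ _ _ _ _ _ (hB i j l p)); first exact/diffN/cH_cvg.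
    by near=> t; exact: h_bounded.
  apply: (@cvg0_bounded_mulr _ _ _ _ _ _ C); last by apply: C_near => t; exact: c_le.
  apply: cvg0_le_norm; last by near=> t; exact: h_lip.
  have d1 := delayed_cvg j (tauH_cvg i j p) (tau_lim i j p).
  have d2 := delayed_cvg l (tau'H_cvg i l p) (tau'_lim i l p).
  rewrite -[X in _ --> X](_ : gamma1 i j l p * `|0 : R| +
    gamma2 i j l p * `|0 : R| = 0); last first.
    by rewrite normr0 !mulr0 addr0.
  apply: cvgD; apply: cvgM; try exact: cvg_cst.
    exact: (cvg_norm d1).
  exact: (cvg_norm d2).
(* The integrals are the same in both systems, so only the coefficient changes. *)
- have -> : (fun t => dH i j l p t * f i j l p
        (stieltjes_integral (eta i j p) (fun s => g i j p (x (t + s) 0 j)),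
         stieltjes_integral (eta' i l p) (fun s => g' i l p (x (t + s) 0 l))) -
      d i j l p t * f i j l p
        (stieltjes_integral (eta i j p) (fun s => g i j p (x (t + s) 0 j)),
         stieltjes_integral (eta' i l p) (fun s => g' i l p (x (t + s) 0 l)))) =
    (fun t => (dH i j l p t - d i j l p t) * f i j l p
        (stieltjes_integral (eta i j p) (fun s => g i j p (x (t + s) 0 j)),
         stieltjes_integral (eta' i l p) (fun s => g' i l p (x (t + s) 0 l)))).
    by apply/funext => t; rewrite mulrBl.
  apply: (@cvg0_bounded_mulr _ _ _ _ _ _ (fB i j l p)); first exact/diffN/dH_cvg.
  by near=> t; exact: f_bounded.
Unshelve. all: by end_near. Qed.

End inputs.

(** * Continuity, perturbation and boundedness of the gain *)

Section gain_facts.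
Context {R : realType} {n P : nat}.
Variables (gamma1 gamma2 mu1 mu2 : 'I_n -> 'I_n -> 'I_n -> 'I_P -> R)
  (xi xi' : 'I_n -> 'I_n -> 'I_P -> R) (zeta sigma a_up w : 'I_n -> R).

Local Notation gain' c d := (gain c d gamma1 gamma2 mu1 mu2 xi xi' zeta sigma a_up w).

(** Linear in [(u, v)], which stand for the absolute values of the coefficients: a difference of
    gains is a sum of such terms at the differences of absolute values. *)
Let gain_term i j l p (u v : R) :=
  zeta i * u * (a_up j * (w j / w i) * gamma1 i j l p + a_up l * (w l / w i) * gamma2 i j l p)
  + sigma i * v * (a_up j * (w j / w i) * xi i j p * mu1 i j l p
                   + a_up l * (w l / w i) * xi' i l p * mu2 i j l p).

Let cvg_gain_term i j l p (G : set_system R) (FG : Filter G) (u v : R -> R) (u0 v0 : R) :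
  u t @[t --> G] --> u0 -> v t @[t --> G] --> v0 ->
  gain_term i j l p (u t) (v t) @[t --> G] --> gain_term i j l p u0 v0.
Proof.
move=> uu vv; apply: cvgD; apply: cvgM; try exact: cvg_cst.
  by apply: cvgM; [exact: cvg_cst|].
by apply: cvgM; [exact: cvg_cst|].
Qed.

Lemma gain_continuous (c d : 'I_n -> 'I_n -> 'I_n -> 'I_P -> R -> R) i (t : R) :
  (forall j l p, {for t, continuous (c i j l p)}) ->
  (forall j l p, {for t, continuous (d i j l p)}) ->
  {for t, continuous (gain' c d i)}.
Proof.
move=> cc cd; apply: cvg_sumr => p; apply: cvg_sumr => j; apply: cvg_sumr => l.
by apply: (@cvg_gain_term i j l p); apply: cvg_norm; [exact: cc|exact: cd].
Qed.

Lemma gain_diff_cvg0 (c d cH dH : 'I_n -> 'I_n -> 'I_n -> 'I_P -> R -> R) i :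
  (forall j l p, c i j l p t - cH i j l p t @[t --> +oo] --> 0) ->
  (forall j l p, d i j l p t - dH i j l p t @[t --> +oo] --> 0) ->
  gain' cH dH i t - gain' c d i t @[t --> +oo] --> 0.
Proof.
move=> cH0 dH0.
have absd (u v : R -> R) : u t - v t @[t --> +oo] --> 0 -> `|v t| - `|u t| @[t --> +oo] --> 0.
  move=> uv; apply: (@cvg0_le_norm _ _ _ _ _ (fun t => `|u t - v t|)).
    by rewrite -(normr0 R); apply: cvg_norm.
  by near=> t; rewrite distrC ler_dist_dist.
have -> : (fun t => gain' cH dH i t - gain' c d i t) = (fun t =>
    \sum_(p < P) \sum_(j < n) \sum_(l < n) gain_term i j l p
      (`|cH i j l p t| - `|c i j l p t|) (`|dH i j l p t| - `|d i j l p t|)).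
  apply/funext => t; rewrite /gain /gain_term -sumrB; apply: eq_bigr => p _.
  rewrite -sumrB; apply: eq_bigr => j _; rewrite -sumrB; apply: eq_bigr => l _.
  by ring.
have E : \sum_(p < P) \sum_(j < n) \sum_(l < n) gain_term i j l p 0 0 = 0.
  rewrite big1// => p _; rewrite big1// => j _; rewrite big1// => l _.
  by rewrite /gain_term !mulr0 !mul0r addr0.
rewrite -[X in _ --> X]E.
apply: cvg_sumr => p; apply: cvg_sumr => j; apply: cvg_sumr => l.
by apply: cvg_gain_term; apply: absd; [exact: cH0|exact: dH0].
Unshelve. all: by end_near. Qed.

Hypothesis gamma1_gt0 : forall i j l p, 0 < gamma1 i j l p.
Hypothesis gamma2_gt0 : forall i j l p, 0 < gamma2 i j l p.
Hypothesis mu1_gt0 : forall i j l p, 0 < mu1 i j l p.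
Hypothesis mu2_gt0 : forall i j l p, 0 < mu2 i j l p.
Hypothesis xi_gt0 : forall i j p, 0 < xi i j p.
Hypothesis xi'_gt0 : forall i j p, 0 < xi' i j p.
Hypothesis zeta_gt0 : forall i, 0 < zeta i.
Hypothesis sigma_gt0 : forall i, 0 < sigma i.
Hypothesis a_up_gt0 : forall i, 0 < a_up i.
Hypothesis w_gt0 : forall i, 0 < w i.

Lemma gain_bounded (c d : 'I_n -> 'I_n -> 'I_n -> 'I_P -> R -> R) (C : R) (D : set R) :
  (forall i j l p t, D t -> `|c i j l p t| <= C) ->
  (forall i j l p t, D t -> `|d i j l p t| <= C) ->
  exists G, forall i t, D t -> gain' c d i t <= G.
Proof.
move=> cC dC.
have [G _ HG] := finite_bound (fun i =>
  \sum_(p < P) \sum_(j < n) \sum_(l < n) gain_term i j l p C C).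
exists G => i t Dt; apply: le_trans (HG i).
apply: ler_sum => p _; apply: ler_sum => j _; apply: ler_sum => l _.
have := (gamma1_gt0 i j l p, gamma2_gt0 i j l p, mu1_gt0 i j l p, mu2_gt0 i j l p).
have := (zeta_gt0 i, sigma_gt0 i, a_up_gt0 j, a_up_gt0 l, xi_gt0 i j p, xi'_gt0 i l p).
have := (w_gt0 i, w_gt0 j, w_gt0 l).
move=> [[wi wj] wl] [[[[[z s] uj] ul] x] x'] [[[g1 g2] m1] m2].
rewrite /gain_term; apply: lerD; apply: ler_wpM2r.
- by rewrite addr_ge0// !mulr_ge0 ?invr_ge0// ltW.
- by rewrite ler_wpM2l ?cC// ltW.
- by rewrite addr_ge0// !mulr_ge0 ?invr_ge0// ltW.
- by rewrite ler_wpM2l ?dC// ltW.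
Qed.

End gain_facts.

(** * The asymptotic system as a perturbation of the given one *)

Lemma near_pinfty_ge (R : realType) (Q : R -> Prop) :
  (\forall t \near +oo, Q t) -> exists T, forall t, T <= t -> Q t.
Proof.
move=> [T [_ TQ]]; exists (T + 1) => t Tt; apply: TQ.
by apply: lt_le_trans Tt; rewrite ltrDl.
Qed.

Theorem theorem3p3 (R : realType) (n P : nat)
    (a b : 'I_n -> R * R -> R) (F : 'I_n -> R * R -> R)
    (c d : 'I_n -> 'I_n -> 'I_n -> 'I_P -> R -> R)
    (h f : 'I_n -> 'I_n -> 'I_n -> 'I_P -> R * R -> R)
    (tau tau' : 'I_n -> 'I_n -> 'I_P -> R -> R)
    (g g' : 'I_n -> 'I_n -> 'I_P -> R -> R)
    (eta eta' : 'I_n -> 'I_n -> 'I_P -> bounded_nondecreasing R)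
    (I : 'I_n -> R -> R)
    (* standing assumptions on the data *)
    (a_cont : forall i, {within [set z | 0 <= z.1], continuous (a i)})
    (a_gt0 : forall i t u, 0 <= t -> 0 < a i (t, u))
    (b_cont : forall i, {within [set z | 0 <= z.1], continuous (b i)})
    (c_cont : forall i j l p, {within `[0, +oo[, continuous (c i j l p)})
    (d_cont : forall i j l p, {within `[0, +oo[, continuous (d i j l p)})
    (I_cont : forall i, {within `[0, +oo[, continuous (I i)})
    (tau_cont : forall i j p, {within `[0, +oo[, continuous (tau i j p)})
    (tau'_cont : forall i l p, {within `[0, +oo[, continuous (tau' i l p)})
    (tau_ge0 : forall i j p t, 0 <= t -> 0 <= tau i j p t)
    (tau'_ge0 : forall i l p t, 0 <= t -> 0 <= tau' i l p t)
    (F_cont : forall i, continuous (F i))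
    (h_cont : forall i j l p, continuous (h i j l p))
    (f_cont : forall i j l p, continuous (f i j l p))
    (g_cont : forall i j p, continuous (g i j p))
    (g'_cont : forall i l p, continuous (g' i l p))
    (eta_mass : forall i j p,
       eta i j p 0 - lim (eta i j p s @[s --> -oo]) = 1)
    (eta'_mass : forall i l p,
       eta' i l p 0 - lim (eta' i l p s @[s --> -oo]) = 1)
    (* (i) *)
    (c_bounded : forall i j l p, [bounded c i j l p t | t in `[0, +oo[%classic])
    (d_bounded : forall i j l p, [bounded d i j l p t | t in `[0, +oo[%classic])
    (I_bounded : forall i, [bounded I i t | t in `[0, +oo[%classic])
    (b_bounded : forall i u, [bounded b i (t, u) | t in `[0, +oo[%classic])
    (* (ii) *)
    (a_low a_up : 'I_n -> R) (A : 'I_n -> R -> R)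
    (a_low_gt0 : forall i, 0 < a_low i) (a_up_gt0 : forall i, 0 < a_up i)
    (a_bounds : forall i t v, 0 <= t -> a_low i <= a i (t, v) <= a_up i)
    (a_partial : forall i t v, 0 <= t ->
       exists2 da : R,
         derivative_within `[0, +oo[ (fun s => a i (s, v)) t da
         & A i t * a i (t, v) ^+ 2 <= da)
    (* (iii) *)
    (beta : 'I_n -> R -> R)
    (beta_cont : forall i, {within `[0, +oo[, continuous (beta i)})
    (beta_ge0 : forall i t, 0 <= t -> 0 <= beta i t)
    (b_slope : forall i t u v, 0 <= t -> u != v ->
       beta i t <= (b i (t, u) - b i (t, v)) / (u - v))
    (* (iv) *)
    (tau_lim : forall i j p, t - tau i j p t @[t --> +oo] --> +oo)
    (tau'_lim : forall i l p, t - tau' i l p t @[t --> +oo] --> +oo)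
    (* (v) *)
    (gamma1 gamma2 mu1 mu2 : 'I_n -> 'I_n -> 'I_n -> 'I_P -> R)
    (gamma1_gt0 : forall i j l p, 0 < gamma1 i j l p)
    (gamma2_gt0 : forall i j l p, 0 < gamma2 i j l p)
    (mu1_gt0 : forall i j l p, 0 < mu1 i j l p)
    (mu2_gt0 : forall i j l p, 0 < mu2 i j l p)
    (h_lip : forall i j l p u1 u2 v1 v2,
       `|h i j l p (u1, u2) - h i j l p (v1, v2)|
         <= gamma1 i j l p * `|u1 - v1| + gamma2 i j l p * `|u2 - v2|)
    (f_lip : forall i j l p u1 u2 v1 v2,
       `|f i j l p (u1, u2) - f i j l p (v1, v2)|
         <= mu1 i j l p * `|u1 - v1| + mu2 i j l p * `|u2 - v2|)
    (* (vi) *)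
    (xi xi' : 'I_n -> 'I_n -> 'I_P -> R) (zeta sigma : 'I_n -> R)
    (xi_gt0 : forall i j p, 0 < xi i j p)
    (xi'_gt0 : forall i j p, 0 < xi' i j p)
    (zeta_gt0 : forall i, 0 < zeta i) (sigma_gt0 : forall i, 0 < sigma i)
    (g_lip : forall i j p u v,
       `|g i j p u - g i j p v| <= xi i j p * `|u - v|)
    (g'_lip : forall i j p u v,
       `|g' i j p u - g' i j p v| <= xi' i j p * `|u - v|)
    (F_lip : forall i u1 u2 v1 v2,
       `|F i (u1, u2) - F i (v1, v2)|
         <= zeta i * `|u1 - v1| + sigma i * `|u2 - v2|)
    (* (vii) *)
    (w : 'I_n -> R) (w_gt0 : forall i, 0 < w i)
    (limsup_lt0 : forall i,
       (limf_esup (fun t : R =>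
          (- a_low i * (beta i t + A i t)
           + \sum_(p < P) \sum_(j < n) \sum_(l < n)
               (zeta i * `|c i j l p t| *
                  (a_up j * (w j / w i) * gamma1 i j l p
                   + a_up l * (w l / w i) * gamma2 i j l p)
                + sigma i * `|d i j l p t| *
                  (a_up j * (w j / w i) * xi i j p * mu1 i j l p
                   + a_up l * (w l / w i) * xi' i l p * mu2 i j l p)))%R%:E)
          (+oo%R : set_system R) < 0)%E)
    (* the asymptotic system *)
    (bH : 'I_n -> R * R -> R)
    (cH dH : 'I_n -> 'I_n -> 'I_n -> 'I_P -> R -> R)
    (tauH tau'H : 'I_n -> 'I_n -> 'I_P -> R -> R) (IH : 'I_n -> R -> R)
    (asym : asymptotic_system b beta c d tau tau' I bH cH dH tauH tau'H IH)
    (x xH : R -> 'rV[R]_n)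
    (x_sol : solution (rhs a b F c d h f tau tau' g g' eta eta' I) +oo%E x)
    (xH_sol :
       solution (rhs a bH F cH dH h f tauH tau'H g g' eta eta' IH) +oo%E xH) :
  `|x t - xH t| @[t --> +oo] --> (0 : R).
Proof.
move: asym => [_ [_ [_ [_ [tauH_ge0 [bH_slope [b_asym [cd_asym [tau_asym I_asym]]]]]]]]].
have /choice[betaH betaHP] := bH_slope.
pose S := gain c d gamma1 gamma2 mu1 mu2 xi xi' zeta sigma a_up w.
pose SH := gain cH dH gamma1 gamma2 mu1 mu2 xi xi' zeta sigma a_up w.
have [eps eps0 epsP] : exists2 eps, 0 < eps &
    forall i, \forall t \near +oo, S i t + eps <= a_low i * (beta i t + A i t).
  have /choice[e eP] : forall i, exists e, 0 < e /\
      \forall t \near +oo, - a_low i * (beta i t + A i t) + S i t <= - e.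
    by move=> i; have [e e0 eP] := limf_esup_lt0_near (limsup_lt0 i); exists e.
  (* A common margin is found through an upper bound of the inverses; the added 1 keeps it well
     defined when there are no indices. *)
  have [m m0 em] := finite_bound (fun i => (e i)^-1).
  have m1 : 0 < m + 1 by rewrite ltr_wpDl.
  exists (m + 1)^-1; first by rewrite invr_gt0.
  move=> i; have [ei0 ei] := eP i; apply: filterS ei => t.
  have : (m + 1)^-1 <= e i.
    rewrite -[leRHS]invrK lef_pV2 ?posrE ?invr_gt0//.
    by rewrite (le_trans (em i))// lerDl.
  by rewrite mulNr; lra.
(* B is a continuous lower bound of A, which itself may be irregular. *)
pose B i t := (S i t + eps) / a_low i - beta i t.
have aB i t : a_low i * (beta i t + B i t) = S i t + eps.
  by rewrite /B; field; rewrite gt_eqF.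
have [C [C0 cC dC]] : exists C, [/\ 0 <= C,
    forall i j l p t, 0 <= t -> `|c i j l p t| <= C &
    forall i j l p t, 0 <= t -> `|d i j l p t| <= C].
  have [C1 C10 cC1] := @uniform_bound R ('I_n * 'I_n * 'I_n * 'I_P)%type `[0, +oo[%classic
    (fun k => c k.1.1.1 k.1.1.2 k.1.2 k.2) (fun k => c_bounded _ _ _ _).
  have [C2 C20 dC2] := @uniform_bound R ('I_n * 'I_n * 'I_n * 'I_P)%type `[0, +oo[%classic
    (fun k => d k.1.1.1 k.1.1.2 k.1.2 k.2) (fun k => d_bounded _ _ _ _).
  exists (C1 + C2); split; first exact: addr_ge0.
    move=> i j l p t t0; have := cC1 (i, j, l, p) t; rewrite /= in_itv/= t0 => /(_ isT).
    by move=> h1; rewrite (le_trans h1)// lerDl.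
  move=> i j l p t t0; have := dC2 (i, j, l, p) t; rewrite /= in_itv/= t0 => /(_ isT).
  by move=> h1; rewrite (le_trans h1)// lerDr.
have [T1 x_der] := solution_is_derive x_sol.
have [T1H xH_der] := solution_is_derive xH_sol.
(* (vii) speaks of (S) only. The gain and the slope bound of (S^) differ from those of (S) by terms
   tending to 0, so the same [B] serves (S^) with the margin [eps / 2]. *)
have SH_near i : \forall t \near +oo,
    SH i t - S i t + a_low i * (beta i t - betaH i t) <= eps / 2.
  have [_ _ _ bb] := betaHP i.
  have lim : SH i t - S i t + a_low i * (beta i t - betaH i t) @[t --> +oo] --> 0 + a_low i * 0.
    apply: cvgD; last by apply: cvgM; [exact: cvg_cst|exact: bb].
    by apply: gain_diff_cvg0 => j l p; have [] := cd_asym i j l p.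
  by apply: (cvgr_le _ lim); rewrite mulr0 addr0 divr_gt0.
(* The zero function is a test function available before [xH] is known to be bounded. *)
have b_near i : \forall t \near +oo, `|b i (t, 0) - bH i (t, 0)| <= 1.
  apply: (cvgr0Pnorm_le _).1 ltr01; apply: (b_asym i (fun=> 0)); first exact: cst_continuous.
  by exists 0; split; [exact: num_real|move=> q q0 s _ /=; rewrite normr0 ltW].
have I_near i : \forall t \near +oo, `|I i t - IH i t| <= 1.
  exact: (cvgr0Pnorm_le _).1 (I_asym i) _ ltr01.
have c_near i j l p : \forall t \near +oo, `|c i j l p t - cH i j l p t| <= 1.
  exact: (cvgr0Pnorm_le _).1 (cd_asym i j l p).1 _ ltr01.
have d_near i j l p : \forall t \near +oo, `|d i j l p t - dH i j l p t| <= 1.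
  exact: (cvgr0Pnorm_le _).1 (cd_asym i j l p).2 _ ltr01.
have [T HT] : exists T, forall t, T <= t -> [/\ 0 < t, T1 <= t, T1H <= t,
    (forall i, [/\ S i t + eps <= a_low i * (beta i t + A i t),
      SH i t + eps / 2 <= a_low i * (betaH i t + B i t),
      `|b i (t, 0) - bH i (t, 0)| <= 1 & `|I i t - IH i t| <= 1]) &
    forall i j l p, `|c i j l p t - cH i j l p t| <= 1 /\
      `|d i j l p t - dH i j l p t| <= 1].
  apply: near_pinfty_ge; near=> t; split.
  - by near: t; apply: nbhs_pinfty_gt; exact: num_real.
  - by near: t; apply: nbhs_pinfty_ge; exact: num_real.
  - by near: t; apply: nbhs_pinfty_ge; exact: num_real.
  - near: t; apply: filter_forall => i; near=> t; split.
    + by near: t; exact: epsP.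
    + have : SH i t - S i t + a_low i * (beta i t - betaH i t) <= eps / 2.
        by near: t; exact: SH_near.
      by have := aB i t; lra.
    + by near: t; exact: b_near.
    + by near: t; exact: I_near.
  - near: t; do 4 apply: filter_forall => ?; near=> t; split.
    + by near: t; exact: c_near.
    + by near: t; exact: d_near.
have T_gt0 t : T <= t -> 0 < t by move=> /HT[].
have T_ge0 t : T <= t -> 0 <= t by move=> /T_gt0/ltW.
have a_bounds' i t v : T <= t -> a_low i <= a i (t, v) <= a_up i.
  by move=> /T_ge0; exact: a_bounds.
have [Phi PhiP] : exists Phi : 'I_n -> R -> R -> R, forall i t (u : R), T <= t ->
    is_derive u 1 (Phi i t) (a i (t, u))^-1.
  (* A primitive is chosen for each pair [(i, t)] separately. Its additive constant may depend on
     [t] in any way, since only differences of values at the same time enter. *)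
  have /choice[Phi PhiP] : forall k : 'I_n * R, exists Phi : R -> R,
      T <= k.2 -> forall u : R, is_derive u 1 Phi (a k.1 (k.2, u))^-1.
    move=> [i t] /=; have [Tt|nTt] := pselect (T <= t); last by exists id.
    have [|Phi PhiP] := @primitive_exists R (fun u => (a i (t, u))^-1); last by exists Phi.
    move=> u; apply: cvgV; first by rewrite gt_eqF// a_gt0// T_ge0.
    exact: (within_half_plane_section (a_cont i) (T_ge0 _ Tt)).
  by exists (fun i t => Phi (i, t)) => i t u Tt; exact: PhiP (i, t) Tt u.
have a_inv_decr i s t u mu : T <= s -> s <= t -> (forall q, s <= q <= t -> mu <= B i q) ->
    (a i (t, u))^-1 - (a i (s, u))^-1 <= - mu * (t - s).
  move=> Ts st muB.
  have /choice[da daP] : forall q, exists da, T <= q ->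
      is_derive (q : R) 1 (fun s => a i (s, u)) da /\ A i q * a i (q, u) ^+ 2 <= da.
    move=> q; have [Tq|nTq] := pselect (T <= q); last by exists 0.
    have [da dP Ada] := a_partial i q u (T_ge0 _ Tq).
    exists da => _; split => //; apply: derivative_within_is_derive dP.
    near=> r; rewrite /= in_itv/= andbT; apply: ltW; near: r.
    by apply: lt_nbhsr; exact: T_gt0.
  have Tq q : s <= q <= t -> T <= q by move=> /andP[/(le_trans Ts)].
  apply: (@inv_decrement R (fun s => a i (s, u)) da) => // q sqt.
  - by rewrite a_gt0// T_ge0// Tq.
  - by have [] := daP _ (Tq _ sqt).
  - have [_] := daP _ (Tq _ sqt); apply: le_trans.
    rewrite ler_wpM2r ?sqr_ge0// (le_trans (muB _ sqt))//.
    have [_ _ _ /(_ i)[h1 _ _ _] _] := HT _ (Tq _ sqt).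
    by move: h1; rewrite -aB ler_pM2l// lerD2l.
have B_cont i t : T <= t -> {for t, continuous (B i)}.
  move=> /T_gt0 t0; apply: cvgB; last exact: within_itv0_continuous_at.
  apply: cvgM; last exact: cvg_cst.
  apply: cvgD; last exact: cvg_cst.
  by apply: gain_continuous => j l p; exact: within_itv0_continuous_at.
have xc := solution_coord_continuous x_sol.
have xHc := solution_coord_continuous xH_sol.
have xp := solution_past_bounded x_sol.
have xHp := solution_past_bounded xH_sol.
have xr i t : T <= t -> (x s 0 i - x t 0 i) / (s - t) @[s --> t^'+] -->
    rhs a b F c d h f tau tau' g g' eta eta' I x i t.
  by move=> /HT[_ T1t _ _ _]; apply: is_derive_right_slope; exact: x_der.
have xHr i t : T <= t -> (xH s 0 i - xH t 0 i) / (s - t) @[s --> t^'+] -->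
    rhs a bH F cH dH h f tauH tau'H g g' eta eta' IH xH i t.
  by move=> /HT[_ _ T1t _ _]; apply: is_derive_right_slope; exact: xH_der.
have cHC i j l p t : T <= t -> `|cH i j l p t| <= C + 1.
  move=> Tt; have [_ _ _ _ /(_ i j l p)[h1 _]] := HT _ Tt.
  have := cC i j l p t (T_ge0 _ Tt); rewrite distrC in h1.
  by move=> h2; rewrite -[cH _ _ _ _ _](subrKC (c i j l p t)) (le_trans (ler_normD _ _))// lerD.
have dHC i j l p t : T <= t -> `|dH i j l p t| <= C + 1.
  move=> Tt; have [_ _ _ _ /(_ i j l p)[_ h1]] := HT _ Tt.
  have := dC i j l p t (T_ge0 _ Tt); rewrite distrC in h1.
  by move=> h2; rewrite -[dH _ _ _ _ _](subrKC (d i j l p t)) (le_trans (ler_normD _ _))// lerD.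
have zero_cont (j : 'I_n) : continuous (fun s : R => (0 : 'rV[R]_n) 0 j).
  by move=> s; exact: cvg_cst.
have zero_le (t : R) (j : 'I_n) : `|(0 : 'rV[R]_n) 0 j| <= (0 : R) by rewrite mxE normr0.
have zero_past : past_bounded (fun=> 0 : 'rV[R]_n) by move=> t; exists 0 => s j _; exact: zero_le.
have [CI CI0 IC] := uniform_bound I_bounded.
have IHC i t : T <= t -> `|IH i t| <= CI + 1.
  move=> Tt; have [_ _ _ /(_ i)[_ _ _ h1] _] := HT _ Tt.
  have h2 : `|I i t| <= CI by apply: IC; rewrite /= in_itv/= T_ge0.
  rewrite distrC in h1.
  by rewrite -[IH _ _](subrKC (I i t)) (le_trans (ler_normD _ _))// lerD.
(* The zero function solves the asymptotic system up to a bounded defect. *)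
have [M [M0 xHM]] : exists M, 0 <= M /\ forall t j, `|xH t 0 j| <= M.
  have [K K0 FK] := delayed_input_bounded gamma1_gt0 gamma2_gt0 mu1_gt0 mu2_gt0 h_lip f_lip
    xi_gt0 xi'_gt0 zeta_gt0 sigma_gt0 g_lip g'_lip F_lip eta_mass eta'_mass g_cont g'_cont
    zero_cont (lexx 0) zero_le tauH tau'H cHC dHC.
  have [Cb Cb0 bC] := uniform_bound (fun i => b_bounded i 0).
  pose r i t := bH i (t, 0) -
    F i (delayed_input cH dH h f tauH tau'H g g' eta eta' (fun=> 0) i t) - IH i t.
  have rK i t : T <= t -> `|r i t| <= (Cb + 1) + K + (CI + 1).
    move=> Tt; have [_ _ _ /(_ i)[_ _ h1 _] _] := HT _ Tt.
    have h2 : `|b i (t, 0)| <= Cb by apply: bC; rewrite /= in_itv/= T_ge0.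
    rewrite (le_trans (ler_normB _ _))// lerD ?IHC// (le_trans (ler_normB _ _))// lerD ?FK//.
    rewrite distrC in h1.
    by rewrite -[bH _ _](subrKC (b i (t, 0))) (le_trans (ler_normD _ _))// lerD.
  have eps2 : 0 < eps / 2 by rewrite divr_gt0.
  have zero_der i t : T <= t ->
      ((0 : 'rV[R]_n) 0 i - (0 : 'rV[R]_n) 0 i) / (s - t) @[s --> t^'+] -->
      a i (t, (0 : 'rV[R]_n) 0 i) * (- bH i (t, (0 : 'rV[R]_n) 0 i) +
        F i (delayed_input cH dH h f tauH tau'H g g' eta eta' (fun=> 0) i t) + IH i t + r i t).
    move=> _; rewrite [X in _ --> X](_ : _ = 0); last by rewrite /r mxE; ring.
    by rewrite subrr; under eq_fun do rewrite mul0r; exact: cvg_cst.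
  have [M xM] := dist_bounded gamma1_gt0 gamma2_gt0 mu1_gt0 mu2_gt0 h_lip f_lip xi_gt0
    xi'_gt0 zeta_gt0 sigma_gt0 g_lip g'_lip F_lip a_up_gt0 a_low_gt0 w_gt0 eta_mass eta'_mass
    g_cont g'_cont eps2 a_bounds' PhiP a_inv_decr B_cont
    (fun i t u v H => let: And4 _ _ h1 _ := betaHP i in h1 t u v (T_ge0 _ H))
    (fun i t H => let: And5 _ _ _ h1 _ := HT t H in let: And4 _ h2 _ _ := h1 i in h2)
    (fun i j p t H => (tauH_ge0 i j p t (T_ge0 _ H)).1)
    (fun i j p t H => (tauH_ge0 i j p t (T_ge0 _ H)).2)
    xHc zero_cont xHp zero_past xHr zero_der rK.
  exists `|M|; split => // t j; have := xM t j; rewrite mxE subr0 => h1.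
  exact: le_trans (ler_norm _).
have b_mono i t u v : T <= t -> v <= u -> b i (t, v) <= b i (t, u).
  move=> Tt; rewrite le_eqVlt => /predU1P[->//|vu].
  have := b_slope i t u v (T_ge0 _ Tt); rewrite gt_eqF// => /(_ isT).
  move=> /(le_trans (beta_ge0 i t (T_ge0 _ Tt))).
  by rewrite pmulr_lge0 ?invr_gt0 ?subr_gt0// subr_ge0.
have bb_cvg i : b i (t, xH t 0 i) - bH i (t, xH t 0 i) @[t --> +oo] --> 0.
  apply: b_asym; first exact: xHc.
  exists M; split; first exact: num_real.
  by move=> q Mq s _ /=; rewrite (le_trans (xHM _ _))// ltW.
have [L [T3 [TT3 xHL]]] : exists L T3, (forall t, T3 <= t -> T <= t) /\
    forall j s t, T3 <= s -> T3 <= t -> `|xH t 0 j - xH s 0 j| <= L * `|t - s|.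
  have [K K0 FK] := delayed_input_bounded gamma1_gt0 gamma2_gt0 mu1_gt0 mu2_gt0 h_lip f_lip
    xi_gt0 xi'_gt0 zeta_gt0 sigma_gt0 g_lip g'_lip F_lip eta_mass eta'_mass g_cont g'_cont
    xHc M0 xHM tauH tau'H cHC dHC.
  (* (i) bounds [b i (t, u)] only for each fixed [u]. Monotonicity in [u] squeezes
     [b i (t, xH t 0 i)] between its values at [- M] and [M], and [bb_cvg] transfers the bound to
     [bH]. *)
  have [C1 C10 bC1] := uniform_bound (fun i => b_bounded i M).
  have [C2 C20 bC2] := uniform_bound (fun i => b_bounded i (- M)).
  have [T3 HT3] : exists T3, forall t, T3 <= t -> T <= t /\
      forall i, `|b i (t, xH t 0 i) - bH i (t, xH t 0 i)| <= 1.
    apply: near_pinfty_ge; near=> t; split.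
      by near: t; apply: nbhs_pinfty_ge; exact: num_real.
    near: t; apply: filter_forall => i.
    exact: (cvgr0Pnorm_le _).1 (bb_cvg i) _ ltr01.
  have [A0 A00 upA] := finite_bound a_up.
  exists (A0 * ((C1 + C2 + 1) + K + (CI + 1))), T3; split => [t /HT3[]//|j].
  apply: (@lipschitz_of_derive R (fun s => xH s 0 j)
    (rhs a bH F cH dH h f tauH tau'H g g' eta eta' IH xH j)).
    by move=> t /HT3[/HT[_ _ h1 _ _] _]; exact: xH_der.
  move=> t /HT3[Tt /(_ j) h1]; rewrite /rhs normrM; apply: ler_pM => //.
    have /andP[al au] := a_bounds' j t (xH t 0 j) Tt.
    by rewrite gtr0_norm ?(lt_le_trans _ al)// (le_trans au).
  rewrite (le_trans (ler_normD _ _))// lerD ?IHC//.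
  rewrite (le_trans (ler_normD _ _))// lerD ?FK// normrN.
  have t0 := T_ge0 _ Tt.
  have : `|b j (t, M)| <= C1 by apply: bC1; rewrite /= in_itv/= t0.
  have : `|b j (t, - M)| <= C2 by apply: bC2; rewrite /= in_itv/= t0.
  have := xHM t j; rewrite ler_norml => /andP[m1 m2].
  have b1 := b_mono j _ _ _ Tt m1; have b2 := b_mono j _ _ _ Tt m2.
  move: h1; rewrite !ler_norml => /andP[h1 h2] /andP[h3 h4] /andP[h5 h6].
  apply/andP; split; lra.
(* xH solves the first system up to the defect r. *)
pose r i t := (b i (t, xH t 0 i) - bH i (t, xH t 0 i)) +
  (F i (delayed_input cH dH h f tauH tau'H g g' eta eta' xH i t) -
   F i (delayed_input c d h f tau tau' g g' eta eta' xH i t)) - (I i t - IH i t).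
have r0 i : r i t @[t --> +oo] --> 0.
  have lim1 := @delayed_input_cvg0 R n P F h f g g' eta eta' _ _ _ _ _ _ _ _ gamma1_gt0 gamma2_gt0
    mu1_gt0 mu2_gt0 h_lip f_lip xi_gt0 xi'_gt0 g_lip g'_lip F_lip eta_mass eta'_mass g_cont g'_cont
    xH M xHc M0 xHM c d tau tau' T3 C (fun i j l p t H => cC i j l p t (T_ge0 _ (TT3 _ H)))
    cH dH tauH tau'H L xHL (fun i j l p => (cd_asym i j l p).1) (fun i j l p => (cd_asym i j l p).2)
    (fun i j p => (tau_asym i j p).1) (fun i j p => (tau_asym i j p).2) tau_lim tau'_lim i.
  have -> : (0 : R) = 0 + 0 - 0 by rewrite addr0 subr0.
  apply: cvgB; last exact: I_asym.
  by apply: cvgD; [exact: bb_cvg|exact: lim1].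
have [T2 HT2] : exists T2, forall t, T2 <= t -> T <= t /\ forall i, `|r i t| <= 1.
  apply: near_pinfty_ge; near=> t; split.
    by near: t; apply: nbhs_pinfty_ge; exact: num_real.
  near: t; apply: filter_forall => i.
  exact: (cvgr0Pnorm_le _).1 (r0 i) _ ltr01.
have TT2 t : T2 <= t -> T <= t by move=> /HT2[].
have eps_gain i t : T2 <= t -> gain c d gamma1 gamma2 mu1 mu2 xi xi' zeta sigma a_up w i t +
    eps <= a_low i * (beta i t + B i t).
  by rewrite aB.
have T2_ge0 t : T2 <= t -> 0 <= t by move=> /TT2/T_ge0.
have y_der i t : T2 <= t -> (xH s 0 i - xH t 0 i) / (s - t) @[s --> t^'+] -->
    a i (t, xH t 0 i) * (- b i (t, xH t 0 i) +
      F i (delayed_input c d h f tau tau' g g' eta eta' xH i t) + I i t + r i t).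
  move=> /TT2 Tt; rewrite [X in _ --> X](_ : _ =
    rhs a bH F cH dH h f tauH tau'H g g' eta eta' IH xH i t); first exact: xHr.
  rewrite /rhs -/(delayed_input cH dH h f tauH tau'H g g' eta eta' xH i t) /r; ring.
(* This global bound on [x - xH] is the constant that multiplies the tails of the integrals in the
   contraction argument. *)
have [N xN] := dist_bounded gamma1_gt0 gamma2_gt0 mu1_gt0 mu2_gt0 h_lip f_lip xi_gt0
  xi'_gt0 zeta_gt0 sigma_gt0 g_lip g'_lip F_lip a_up_gt0 a_low_gt0 w_gt0 eta_mass eta'_mass
  g_cont g'_cont eps0 (fun i t v H => @a_bounds' i t v (TT2 _ H))
  (fun i t v H => PhiP i t v (TT2 _ H))
  (fun i s t u mu H => @a_inv_decr i s t u mu (TT2 _ H)) (fun i t H => @B_cont i t (TT2 _ H))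
  (fun i t u v H => @b_slope i t u v (T2_ge0 _ H)) eps_gain
  (fun i j p t H => tau_ge0 i j p t (T2_ge0 _ H)) (fun i j p t H => tau'_ge0 i j p t (T2_ge0 _ H))
  xc xHc xp xHp (fun i t H => @xr i t (TT2 _ H)) y_der (fun i t H => (HT2 t H).2 i).
have [G gainG] := gain_bounded gamma1_gt0 gamma2_gt0 mu1_gt0 mu2_gt0 xi_gt0
  xi'_gt0 zeta_gt0 sigma_gt0 a_up_gt0 w_gt0 (D := [set t | 0 <= t]) cC dC.
have xy0 := dist_cvg0 gamma1_gt0 gamma2_gt0 mu1_gt0 mu2_gt0 h_lip f_lip xi_gt0
  xi'_gt0 zeta_gt0 sigma_gt0 g_lip g'_lip F_lip a_up_gt0 a_low_gt0 w_gt0 eta_mass eta'_mass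
  g_cont g'_cont eps0 (fun i t v H => @a_bounds' i t v (TT2 _ H))
  (fun i t v H => PhiP i t v (TT2 _ H))
  (fun i s t u mu H => @a_inv_decr i s t u mu (TT2 _ H)) (fun i t H => @B_cont i t (TT2 _ H))
  (fun i t u v H => @b_slope i t u v (T2_ge0 _ H)) eps_gain
  xc xHc xp xHp (fun i t H => @xr i t (TT2 _ H)) y_der xN
  (fun i t H => gainG i t (T2_ge0 _ H)) r0 tau_lim tau'_lim.
apply/cvgr0Pnorm_le => e e0.
have near_e : \forall t \near +oo, forall i, `|x t 0 i - xH t 0 i| <= e.
  by apply: filter_forall => i; apply: ((cvgr0Pnorm_le _).1 (xy0 i)).
apply: filterS near_e => t xe; rewrite normr_id; apply: norm_le_coord; first exact: ltW.
by move=> j; rewrite !mxE.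
Unshelve. all: by end_near. Qed.
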